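(* Let $D$ be a positive integer, let $(Z,\mathbb{Z}^k,S)$ be an aperiodic zero-dimensional system, and let $\pi:X\to Z$ be an extension, where $(X,\mathbb{Z}^k,T)$ is a dynamical system with $\mathrm{mdim}(X)<D/2$. Then for a dense $G_\delta$ subset of $f\in C(X,[0,1]^D)$ the map $(I_f,\pi):X\to([0,1]^D)^{\mathbb{Z}^k}\times Z$, $x\mapsto(I_f(x),\pi(x))$, is a topological embedding.
   Context: Dynamical system: compact metric space with continuous $\mathbb{Z}^k$-action. Aperiodic: the action is free. Zero-dimensional: clopen subsets form a basis of the topology. An extension $\pi:X\to Z$ is a $\mathbb{Z}^k$-equivariant continuous surjection. $C(X,[0,1]^D)$ carries the uniform topology. $I_f(x)=(f(T^nx))_{n\in\mathbb{Z}^k}$. Mean dimension: with $[N]=\{0,\dots,N-1\}^k$, $d_\Omega(x,y)=\sup_{n\in\Omega}d(T^nx,T^ny)$, a continuous $f:(X,d)\to Y$ is an $\varepsilon$-embedding if $\mathrm{diam}\,f^{-1}(y)<\varepsilon$ for all $y$, $\mathrm{widim}_\varepsilon(X,d)$ is the minimal dimension of a finite simplicial complex admitting an $\varepsilon$-embedding, and $\mathrm{mdim}(X)=\lim_{\varepsilon\to0}\lim_{N\to\infty}N^{-k}\mathrm{widim}_\varepsilon(X,d_{[N]})$. *)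

(* Defs.v *)
From HB Require Import structures.
From mathcomp Require Import all_boot all_order all_algebra.
From mathcomp Require Import all_classical all_reals all_analysis.
Import numFieldNormedType.Exports.
Set Implicit Arguments. Unset Strict Implicit. Unset Printing Implicit Defensive.
Import Order.TTheory GRing.Theory Num.Theory.
Local Open Scope classical_set_scope.
Local Open Scope ring_scope.

Definition is_action (k : nat) (Y : topologicalType) (T : 'rV[int]_k -> Y -> Y) :=
  [/\ (forall y, T 0 y = y),
      (forall m n y, T (m + n) y = T m (T n y)) &
      (forall n, continuous (T n))].

Definition aperiodic (k : nat) (Y : Type) (T : 'rV[int]_k -> Y -> Y) :=
  forall n y, T n y = y -> n = 0.

Definition zero_dim_basis (Y : topologicalType) :=
  forall (U : set Y) (y : Y), open U -> U y ->
    exists C : set Y, [/\ clopen C, C y & C `<=` U].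

Definition is_extension (k : nat) (X Z : topologicalType)
    (T : 'rV[int]_k -> X -> X) (S : 'rV[int]_k -> Z -> Z) (pi : X -> Z) :=
  [/\ continuous pi, (forall z, exists x, pi x = z) &
      (forall n x, pi (T n x) = S n (pi x))].

Definition boxN (k N : nat) : set 'rV[int]_k :=
  [set n | forall i, (0 <= n ord0 i)%R /\ (n ord0 i < N%:Z)%R].

Arguments boxN : clear implicits.

Definition dOmega {R : realType} (k : nat) (X : metricType R)
    (T : 'rV[int]_k -> X -> X) (Om : set 'rV[int]_k) (x y : X) : R :=
  sup [set mdist (T n x) (T n y) | n in Om].

Definition diam {R : realType} (X : Type) (dd : X -> X -> R) (A : set X) : R :=
  sup [set dd p.1 p.2 | p in A `*` A].

(** Finite (abstract) simplicial complexes on the vertex set 'I_m, with their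
    geometric realization in R^m (barycentric coordinates). *)
Definition is_complex (m : nat) (K : {set {set 'I_m}}) :=
  (forall s, s \in K -> (0 < #|s|)%N) /\
  (forall (s t : {set 'I_m}), s \in K -> t \subset s -> (0 < #|t|)%N -> t \in K).

Definition cdim (m : nat) (K : {set {set 'I_m}}) : nat :=
  \max_(s in K) (#|s|.-1).

Definition realization {R : realType} (m : nat) (K : {set {set 'I_m}})
  : set 'rV[R]_m :=
  [set t | (forall i, 0 <= t ord0 i) /\ (\sum_i t ord0 i = 1) /\
           finset (fun i => t ord0 i != 0) \in K].

Definition eps_embedding {R : realType} (X : Type) (dd : X -> X -> R)
    (eps : R) (Y : Type) (f : X -> Y) :=
  forall y : Y, diam dd (f @^-1` [set y]) < eps.

Definition widim {R : realType} (X : topologicalType) (dd : X -> X -> R)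
    (eps : R) : \bar R :=
  ereal_inf [set e : \bar R | exists (m : nat) (K : {set {set 'I_m}}),
     [/\ is_complex K,
         (exists f : X -> 'rV[R]_m, [/\ continuous f,
              (forall x, realization K (f x)) & eps_embedding dd eps f]) &
         e = ((cdim K)%:R)%:E]].

Definition mdim {R : realType} (k : nat) (X : metricType R)
    (T : 'rV[int]_k -> X -> X) : \bar R :=
  lim (limn (fun N : nat =>
            (widim (dOmega T (boxN k N)) eps * ((N ^ k)%:R^-1)%:E)%E)
       @[eps --> (0:R)^'+]).

Definition Iorbit {R : realType} (k D : nat) (X : Type)
    (T : 'rV[int]_k -> X -> X) (f : X -> 'rV[R]_D) (x : X)
  : {ptws 'rV[int]_k -> 'rV[R]_D} :=
  fun n => f (T n x).

Definition top_embedding (A B : topologicalType) (h : A -> B) :=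
  [/\ injective h, continuous h &
      forall U : set A, open U ->
        exists V : set B, open V /\ h @` U = h @` setT `&` V].

Definition cube_maps {R : realType} (D : nat) (X : topologicalType)
  : set {uniform X -> 'rV[R]_D} :=
  [set f | continuous (f : X -> 'rV[R]_D) /\
           forall x i, 0 <= (f : X -> 'rV[R]_D) x ord0 i <= 1].

Arguments cube_maps : clear implicits.

Definition dense_Gdelta_in (Y : topologicalType) (C G : set Y) :=
  [/\ G `<=` C, C `<=` closure G &
      exists U : nat -> set Y, (forall n, open (U n)) /\
                               G = C `&` \bigcap_n U n].

(* Main.v *)
(* Baire category: it suffices to approximate a given f by maps g whose values along
   orbits separate any two points of the same fibre of pi at distance at least eta.
   Since Z is zero-dimensional and free it carries clopen marker sets, and these cut
   every orbit Z^k into large tiles of finitely many shapes; the tiling of the orbit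
   of x depends only on pi(x), and does so locally constantly.  The number of
   translates of a fixed box [N]^k needed to cover a tile Om exceeds |Om| / N^k only
   by a negligible boundary term, so widim(X, d_Om) < D |Om| / 2 for every tile.  In
   terms of partitions of unity of multiplicity w + 1 with 2 w < D |Om|, general
   position then perturbs the map x |-> (f (T^p x)), p in Om, into an eps-embedding
   for d_Om, and g reads off the coordinate of this map prescribed by the tile
   containing the origin. *)
Require Import Defs.
From HB Require Import structures.
From mathcomp Require Import all_boot all_order all_algebra.
From mathcomp Require Import finmap.
From mathcomp Require Import all_classical all_reals all_analysis.
From mathcomp Require Import ring lra zify.
Import numFieldNormedType.Exports.
Import Order.TTheory GRing.Theory Num.Theory.
Local Open Scope classical_set_scope.
Local Open Scope ring_scope.
Set Implicit Arguments.
Unset Strict Implicit.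

(** * Partitions of unity of bounded multiplicity *)

(** The bound [2 w < D |Om|] is the classical embedding condition: the partition functions of two
    points involve at most [2 w + 2 <= D |Om| + 1] vertices, and so many points in general position
    in dimension [D |Om|] are affinely independent. To reach it, the widths of the boxes covering a
    tile must add up exactly. Multiplying two partitions of unity would give multiplicity
    [(w1 + 1) (w2 + 1)]; the coupling in [pou_prod] gives [w1 + w2 + 1]. The perturbed maps are
    chosen once for each tile shape, never for each point. Nearby points then use the same map,
    which gives continuity of [g]. Two points of one fibre have the same tiling, so equality of
    their [g]-orbits equates all coordinates of a single perturbed map. *)

Lemma continuous_bigsum {R : realType} {X : topologicalType} (I : Type)
    (r : seq I) (P : pred I) (f : I -> X -> R) :
  (forall i, continuous (f i)) ->
  continuous (fun x => \sum_(i <- r | P i) f i x).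
Proof.
move=> fc; elim: r => [|i r IH] x.
  by under eq_fun do rewrite big_nil; exact: cvg_cst.
under eq_fun do rewrite big_cons.
case: ifP => _; last exact: IH.
by apply: cvgD; [exact: fc|exact: IH].
Qed.

Lemma continuous_bigprod {R : realType} {X : topologicalType} (I : Type)
    (r : seq I) (P : pred I) (f : I -> X -> R) :
  (forall i, continuous (f i)) ->
  continuous (fun x => \prod_(i <- r | P i) f i x).
Proof.
move=> fc; elim: r => [|i r IH] x.
  by under eq_fun do rewrite big_nil; exact: cvg_cst.
under eq_fun do rewrite big_cons.
case: ifP => _; last exact: IH.
by apply: cvgM; [exact: fc|exact: IH].
Qed.

(** Stands for a map to a complex of dimension [w], the functions being barycentric coordinates in
    the nerve of their supports. An arbitrary relation [close] allows products and pullbacks without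
    any metric. *)
Definition pou {R : realType} {X : topologicalType} (close : X -> X -> Prop)
    (w : nat) : Prop :=
  exists (n : nat) (psi : 'I_n -> X -> R),
  [/\ forall v, continuous (psi v), forall v x, 0 <= psi v x,
      forall x, \sum_v psi v x = 1,
      forall x, (#|[pred v | (psi v x != 0)%R]| <= w.+1)%N &
      forall v x y, psi v x != 0 -> psi v y != 0 -> close x y].

(** The product over [l] of the positive parts of [g v l] is nonzero exactly where all inequalities
    of [v] hold; dividing by the sum over [v] normalises. *)
Lemma pou_of_ineq {R : realType} {X : topologicalType} (close : X -> X -> Prop)
    (w : nat) (V L : finType) (g : V -> L -> X -> R) :
  (forall v l, continuous (g v l)) ->
  (forall x, exists v, forall l, 0 < g v l x) ->
  (forall x, (#|[pred v | [forall l, (0 < g v l x)%R]]| <= w.+1)%N) ->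
  (forall v x y, (forall l, 0 < g v l x) -> (forall l, 0 < g v l y) ->
     close x y) ->
  @pou R X close w.
Proof.
move=> gc gex gw gcl.
pose chi v x : R := \prod_l Num.max 0 (g v l x).
have chi0 v x : 0 <= chi v x by apply: prodr_ge0 => l _; rewrite le_max lexx.
have chiP v x : (chi v x != 0) = [forall l, 0 < g v l x].
  apply/idP/forallP => [/prodf_neq0 + l|gl].
    by move=> /(_ l isT); case: ltP => // _; rewrite eqxx.
  by apply/prodf_neq0 => l _; rewrite max_r ?ltW// gt_eqF.
have chic v : continuous (chi v).
  apply: continuous_bigprod => l x.
  by apply: continuous_max; [exact: cvg_cst|exact: gc].
pose s x : R := \sum_v chi v x.
have s0 x : 0 < s x.
  have [v vx] := gex x; rewrite /s (bigD1 v)//= ltr_pwDl//; last first.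
    by apply: sumr_ge0.
  by rewrite lt_neqAle chi0 andbT eq_sym chiP; apply/forallP.
have sc : continuous s by apply: continuous_bigsum.
exists #|V|, (fun i x => chi (enum_val i) x / s x).
have supp i x : (chi (enum_val i) x / s x != 0) = [forall l, 0 < g (enum_val i) l x].
  by rewrite mulf_eq0 invr_eq0 (gt_eqF (s0 x)) orbF chiP.
split.
- move=> i x; apply: cvgM; first exact: chic.
  by apply: cvgV; [rewrite gt_eqF|exact: sc].
- by move=> i x; rewrite divr_ge0// ltW.
- move=> x; rewrite -mulr_suml -(big_enum_val (chi^~ x))/=.
  by rewrite divff// gt_eqF// -/(s x).
- move=> x; apply: leq_trans (gw x).
  rewrite -(fintype.card_image (@enum_val_inj _ _)); apply: subset_leq_card.
  apply/fintype.subsetP => v /fintype.imageP[i]; rewrite inE /= supp => gi ->.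
  by rewrite inE.
- by move=> i x y; rewrite !supp => /forallP + /forallP; exact: gcl.
Qed.

(** A witness determines its element, so choosing witnesses is injective. It serves to bound
    multiplicities by counting breakpoints. *)
Lemma card_le_of_rel (V : finType) (U : eqType) (A : {pred V}) (s : seq U)
    (rel : U -> V -> Prop) :
  (forall u v v', rel u v -> rel u v' -> v = v') ->
  (forall v, v \in A -> exists2 u, u \in s & rel u v) ->
  (#|A| <= size s)%N.
Proof.
move=> relI relA.
have /choice[f fP] : forall v : {v | v \in A}, exists u,
    u \in s /\ rel u (val v).
  by case=> v /= /relA[u us uv]; exists u.
have -> : #|A| = size [seq f v | v <- enum {: {v | v \in A}}].
  by rewrite size_map -cardE card_sig.
apply: uniq_leq_size.
  rewrite map_inj_uniq ?enum_uniq// => v v' ff'; apply: val_inj.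
  by apply: (relI (f v)); [exact: (fP v).2|rewrite ff'; exact: (fP v').2].
by move=> u /mapP[v _ ->]; exact: (fP v).1.
Qed.

Definition psum {R : realType} {n : nat} (t : 'I_n -> R) (m : nat) : R :=
  \sum_(j < n | (j < m)%N) t j.

Section partial_sums.
Context {R : realType} {n : nat} (t : 'I_n -> R).
Hypothesis t0 : forall i, 0 <= t i.

Lemma psum0 : psum t 0 = 0.
Proof. by rewrite /psum big1. Qed.

Lemma psumS (i : 'I_n) : psum t i.+1 = psum t i + t i.
Proof.
rewrite /psum (bigD1 i)//= addrC; congr (_ + _).
by apply: eq_bigl => j; rewrite ltnS ltn_neqAle andbC.
Qed.

Lemma psum_le (m m' : nat) : (m <= m')%N -> psum t m <= psum t m'.
Proof.
move=> mm'; rewrite /psum big_mkcond [leRHS]big_mkcond; apply: ler_sum => j _.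
case: ifPn => [jm|_]; first by rewrite (leq_trans jm mm').
by case: ifP.
Qed.

Lemma psum_ge0 m : 0 <= psum t m.
Proof. by rewrite -psum0 psum_le. Qed.

Hypothesis t1 : \sum_i t i = 1.

Lemma psum_all m : (n <= m)%N -> psum t m = 1.
Proof.
move=> nm; rewrite -t1; apply: eq_bigl => j.
by rewrite (leq_trans (ltn_ord j) nm).
Qed.

Lemma psum_le1 m : psum t m <= 1.
Proof.
by rewrite -(psum_all (leq_maxl n m)) psum_le// leq_maxr.
Qed.

(** The intervals are open on the left, so that an empty one ([t i = 0]) is never found and the
    others partition [(0, 1]]. *)
Lemma psum_locate r : 0 < r <= 1 -> exists i : 'I_n, psum t i < r <= psum t i.+1.
Proof.
move=> /andP[r0 r1].
have ex : exists m, r <= psum t m by exists n; rewrite psum_all.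
have := ex_minnP ex; case: ex_minnP => -[|m] rm mmin _.
  by move: rm; rewrite psum0 leNgt r0.
have mn : (m < n)%N.
  rewrite ltnNge; apply/negP => nm; have : (m.+1 <= n)%N.
    by apply: mmin; rewrite psum_all.
  by rewrite ltnNge nm.
exists (Ordinal mn); rewrite rm andbT ltNge; apply/negP => /mmin.
by rewrite /= ltnn.
Qed.

Lemma psum_locate_inj r (i j : 'I_n) :
  psum t i < r <= psum t i.+1 -> psum t j < r <= psum t j.+1 -> i = j.
Proof.
wlog ij : i j / (i <= j)%N.
  by move=> h hi hj; case/orP: (leq_total i j) => ?; [|apply/esym]; apply: h.
move=> /andP[_ ri] /andP[rj _]; apply/val_inj/eqP; rewrite eqn_leq ij/=.
rewrite leqNgt; apply/negP => /psum_le /(le_trans ri).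
by rewrite leNgt rj.
Qed.

End partial_sums.

(* The north-west corner coupling: the pair (i, j) carries weight exactly when
   the i-th interval cut out by the partial sums of [psi] overlaps the j-th
   interval of [phi]; such pairs form a monotone staircase, so the
   multiplicities add up. *)
Lemma pou_prod {R : realType} {X : topologicalType} (c1 c2 : X -> X -> Prop)
    (w1 w2 : nat) :
  @pou R X c1 w1 -> @pou R X c2 w2 ->
  @pou R X (fun x y => c1 x y /\ c2 x y) (w1 + w2).
Proof.
move=> [n [psi [psic psi0 psi1 psiw psicl]]] [m [phi [phic phi0 phi1 phiw phicl]]].
pose T (i : nat) x := psum (psi^~ x) i.
pose S (i : nat) x := psum (phi^~ x) i.
have Tc i : continuous (T i) by apply: continuous_bigsum.
have Sc i : continuous (S i) by apply: continuous_bigsum.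
pose g (v : 'I_n * 'I_m) (l : bool * bool) (x : X) : R :=
  match l with
  | (true, true) => psi v.1 x
  | (true, false) => phi v.2 x
  | (false, true) => S v.2.+1 x - T v.1 x
  | (false, false) => T v.1.+1 x - S v.2 x
  end.
have gP v x : (forall l, 0 < g v l x) <->
    [/\ 0 < psi v.1 x, 0 < phi v.2 x, T v.1 x < S v.2.+1 x & S v.2 x < T v.1.+1 x].
  split=> [h|[h1 h2 h3 h4] [[] []]//=]; last 2 first.
  - by rewrite subr_gt0.
  - by rewrite subr_gt0.
  split; [exact: (h (true, true))|exact: (h (true, false))| |].
    by have := h (false, true); rewrite /= subr_gt0.
  by have := h (false, false); rewrite /= subr_gt0.
apply: (@pou_of_ineq _ _ _ _ _ _ g).
- move=> v [[] []] /=; [exact: psic|exact: phic| |] => x.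
    by apply: cvgB; [exact: Sc|exact: Tc].
  by apply: cvgB; [exact: Tc|exact: Sc].
(* The last nonempty intervals of both partitions end at 1, so they overlap. *)
- move=> x; have h1 : 0 < (1 : R) <= 1 by rewrite ltr01 lexx.
  have [i /andP[i1 i2]] := psum_locate (psi1 x) h1.
  have [j /andP[j1 j2]] := psum_locate (phi1 x) h1.
  exists (i, j); apply/gP; split => /=.
  + have := lt_le_trans i1 i2; rewrite psumS.
    by rewrite ltrDl.
  + have := lt_le_trans j1 j2; rewrite psumS.
    by rewrite ltrDl.
  + exact: lt_le_trans i1 j2.
  + exact: lt_le_trans j1 i2.
- move=> x; have h1 : 0 < (1 : R) <= 1 by rewrite ltr01 lexx.
  have [js /andP[js1 js2]] := psum_locate (phi1 x) h1.
  have js0 : phi js x != 0.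
    have := lt_le_trans js1 js2; rewrite psumS.
    by rewrite ltrDl => /gt_eqF ->.
  (* An overlap is identified by its right endpoint, which is an endpoint of one of the partitions.
     The endpoint 1 belongs to both and is dropped from the second list, which saves the one unit
     needed. *)
  pose s := [seq T i.+1 x | i : 'I_n <- enum [pred i | psi i x != 0]] ++
    [seq S j.+1 x | j : 'I_m <- rem js (enum [pred j | phi j x != 0])].
  have ss : (size s <= (w1 + w2).+1)%N.
    rewrite size_cat !size_map size_rem; last by rewrite mem_enum inE.
    rewrite -!cardE -addSn; apply: leq_add; first exact: psiw.
    by have := phiw x; rewrite -subn1 leq_subLR add1n.
  apply: leq_trans ss.
  apply: (@card_le_of_rel _ _ _ _ (fun (r : R) (v : 'I_n * 'I_m) =>
    (T v.1 x < r <= T v.1.+1 x) /\ (S v.2 x < r <= S v.2.+1 x))).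
    move=> r [i j] [i' j'] /= [h2 h3] [h4 h5].
    by rewrite (psum_locate_inj (psi0^~ x) h2 h4) (psum_locate_inj (phi0^~ x) h3 h5).
  move=> [i j]; rewrite inE => /forallP /gP[/= p1 p2 p3 p4].
  have Ti : T i x < T i.+1 x.
    by rewrite /T psumS ltrDl.
  have Sj : S j x < S j.+1 x.
    by rewrite /S psumS ltrDl.
  have iin : T i.+1 x \in s.
    rewrite mem_cat; apply/orP; left; apply/mapP; exists i => //.
    by rewrite mem_enum inE gt_eqF.
  (* The smaller of the two right endpoints lies in both intervals. *)
  case: (leP (T i.+1 x) (S j.+1 x)) => TS.
    by exists (T i.+1 x) => //=; rewrite Ti p4 TS lexx.
  exists (S j.+1 x) => /=; last by rewrite p3 Sj (ltW TS) lexx.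
  have [jjs|jjs] := eqVneq j js.
    suff : T i.+1 x <= S j.+1 x by rewrite leNgt TS.
    apply: (@le_trans _ _ 1); first exact: (psum_le1 (psi0^~ x) (psi1 x)).
    by rewrite jjs.
  rewrite mem_cat; apply/orP; right; apply/mapP; exists j => //.
  rewrite mem_rem_uniq ?enum_uniq// inE jjs mem_enum inE.
  by rewrite gt_eqF.
- move=> v x y /gP[h1 h2 _ _] /gP[h3 h4 _ _]; split.
    by apply: (psicl v.1); rewrite gt_eqF.
  by apply: (phicl v.2); rewrite gt_eqF.
Qed.

(* Kuhn's triangulation of the grid of mesh [1 / N] in the coordinates
   [y_i = N * (t_0 + ... + t_i)]: the vertices of the cell of [y] are the integer
   points [v] equal to the floor of [y + a] for some [a >= 0]; the minimal such [a]
   is [0] or the distance from some [y_i] to the next integer. *)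
Lemma pou_of_map {R : realType} {X : topologicalType} (close : X -> X -> Prop)
    (w m : nat) (t : 'I_m -> X -> R) (c : R) :
  (forall i, continuous (t i)) -> (forall i x, 0 <= t i x) ->
  (forall x, \sum_i t i x = 1) ->
  (forall x, (#|[pred i | (t i x != 0)%R]| <= w.+1)%N) -> 0 < c ->
  (forall x y, (forall i, `|t i x - t i y| < c) -> close x y) ->
  @pou R X close w.
Proof.
move=> tc t0 t1 tw c0 tcl.
(* Two points of one support have [y]-coordinates less than 2 apart, hence partial sums less than
   [2 / N] apart; [t i] is a difference of two partial sums, whence [4 / N]. *)
pose N := (Num.truncn (4%:R / c)).+1.
have Nc : 4%:R / N%:R < c.
  rewrite ltr_pdivrMr ?ltr0n// mulrC -ltr_pdivrMr//; exact: truncnS_gt.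
pose y (i : nat) x : R := N%:R * psum (t^~ x) i.
have yc i : continuous (y i).
  move=> x; apply: cvgM; first exact: cvg_cst.
  exact: continuous_bigsum.
have y0 i x : 0 <= y i x by rewrite mulr_ge0// psum_ge0//; exact: (t0^~ x).
have yN i x : y i x <= N%:R.
  by rewrite ler_piMr// (psum_le1 (t0^~ x)).
(* Positivity of all these means [max (0, v_i - y_i) < min (1, v_j - y_j + 1)] for all [i], [j],
   that is, some [a] in [[0, 1)] has [v_i = floor (y_i + a)] for every [i]. *)
pose g (v : {ffun 'I_m -> 'I_N.+1}) (l : 'I_m + 'I_m + 'I_m * 'I_m) (x : X) : R :=
  match l with
  | inl (inl i) => (v i)%:R + 1 - y i.+1 x
  | inl (inr i) => 1 + y i.+1 x - (v i)%:R
  | inr ij => 1 + ((v ij.2)%:R - y ij.2.+1 x) - ((v ij.1)%:R - y ij.1.+1 x)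
  end.
have gP v x : (forall l, 0 < g v l x) <->
    [/\ forall i : 'I_m, y i.+1 x < (v i)%:R + 1,
      forall i : 'I_m, (v i)%:R < 1 + y i.+1 x &
      forall i j : 'I_m, (v i)%:R - y i.+1 x < 1 + ((v j)%:R - y j.+1 x)].
  split=> [h|[h1 h2 h3] [[i|i]|[i j]]]/=; rewrite ?subr_gt0//.
  split=> [i|i|i j].
  - by have := h (inl (inl i)); rewrite /= subr_gt0.
  - by have := h (inl (inr i)); rewrite /= subr_gt0.
  - by have := h (inr (i, j)); rewrite /= subr_gt0.
apply: (@pou_of_ineq _ _ _ _ _ _ g).
- move=> v [[i|i]|[i j]] x /=.
  + by apply: cvgB; [exact: cvg_cst|exact: yc].
  + by apply: cvgB; [apply: cvgD; [exact: cvg_cst|exact: yc]|exact: cvg_cst].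
  + apply: cvgB; last by apply: cvgB; [exact: cvg_cst|exact: yc].
    apply: cvgD; first exact: cvg_cst.
    by apply: cvgB; [exact: cvg_cst|exact: yc].
- move=> x.
  have vN i : (Num.truncn (y i x) < N.+1)%N.
    by rewrite ltnS -(ler_nat R) (le_trans _ (yN i x))// truncn_le.
  exists [ffun i : 'I_m => Ordinal (vN i.+1)]; apply/gP.
  have h (i : 'I_m) := truncn_itv (y0 i.+1 x).
  split=> [i|i|i j]; rewrite !ffunE/=.
  + by rewrite natr1; case/andP: (h i).
  + by case/andP: (h i) => ? ?; rewrite (@le_lt_trans _ _ (y i.+1 x))// ltrDr.
  + case/andP: (h i) => hi1 _; case/andP: (h j) => _; rewrite -natr1 => hj2.
    rewrite (@le_lt_trans _ _ 0)// ?subr_le0// addrA subr_gt0 addrC//.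
- move=> x; apply: leq_trans (tw x); rewrite [leqRHS]cardE.
  apply: (@card_le_of_rel _ _ _ _ (fun (j : 'I_m) (v : {ffun 'I_m -> 'I_N.+1}) =>
    exists2 a : R,
    0 <= a < 1 /\ (exists u : nat, u%:R - y j.+1 x = a) &
    forall i : 'I_m, (v i)%:R <= y i.+1 x + a < (v i)%:R + 1)).
    move=> j v v' [a [/andP[a0 a1] [u ua]] av] [a' [/andP[a0' a1'] [u' ua']] av'].
    have natlt (p q : nat) (z : R) : p%:R <= z < p%:R + 1 ->
        q%:R <= z < q%:R + 1 -> p = q.
      by rewrite !natr1 => /truncn_def <- /truncn_def <-.
    have yj : y j.+1 x = u%:R - a by rewrite -ua opprB addrC subrK.
    have yj' : y j.+1 x = u'%:R - a' by rewrite -ua' opprB addrC subrK.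
    have uu' : u = u'.
      have : (u%:R : R) < u'%:R + 1 by lra.
      have : (u'%:R : R) < u%:R + 1 by lra.
      rewrite !natr1 !ltr_nat !ltnS => h1 h2.
      by apply/eqP; rewrite eqn_leq h1 h2.
    have aa' : a = a' by rewrite -ua -ua' uu'.
    apply/ffunP => i; apply/val_inj; apply: (natlt _ _ (y i.+1 x + a)).
      exact: av.
    by rewrite aa'; exact: av'.
  move=> v; rewrite inE => /forallP /gP[v1 v2 v3].
  pose e (i : 'I_m) : R := (v i)%:R - y i.+1 x.
  have h1 : 0 < (1 : R) <= 1 by rewrite ltr01 lexx.
  have loc (r : R) : 0 < r <= 1 -> exists2 j : 'I_m,
      psum (t^~ x) j < r <= psum (t^~ x) j.+1 &
      t j x != 0.
    move=> /(psum_locate (t1 x))[j jr]; exists j => //.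
    case/andP: jr => j1 j2; have := lt_le_trans j1 j2.
    rewrite psumS.
    by rewrite ltrDl => /gt_eqF ->.
  have [js /andP[js1 js2] js0] := loc _ h1.
  have yjs : y js.+1 x = N%:R.
    rewrite /y (_ : psum _ _ = 1) ?mulr1//; apply/eqP.
    by rewrite eq_le js2 (psum_le1 (t0^~ x)).
  (* The minimal [a] for [v] is [max (0, e i0)]. If it is 0, the index [js] serves as witness,
     because [y js.+1 x = N] is an integer. *)
  have [i0 _ i0max] := @arg_maxP _ R _ js xpredT e isT.
  have i0m i : e i <= e i0 by exact: i0max.
  have [ei0|ei0] := leP (e i0) 0.
    exists js; first by rewrite mem_enum inE.
    exists 0; first by rewrite lexx ltr01; split=> //; exists N; rewrite yjs subrr.
    move=> i; rewrite addr0 v1 andbT -subr_le0.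
    exact: le_trans (i0m i) ei0.
  have yi0 : 0 < y i0.+1 x.
    rewrite lt_neqAle y0 andbT; apply/eqP => yi0.
    have := v2 i0; move: ei0; rewrite /e -yi0 subr0 addr0 ltr0n ltrn1.
    by case: (nat_of_ord _).
  (* [j] is the index at which the partial sum of [i0] is first attained; it gives the same [a] and
     has [t j] nonzero, as the count requires. *)
  have [|j /andP[j1 j2] j0] := loc (psum (t^~ x) i0.+1).
    by rewrite (psum_le1 (t0^~ x))// andbT; move: yi0; rewrite pmulr_rgt0.
  have yj : y j.+1 x = y i0.+1 x.
    congr (_ * _); apply/eqP; rewrite eq_le j2 andbT; apply: psum_le => //.
    rewrite ltnS leqNgt; apply/negP => /(psum_le (t0^~ x)).
    by rewrite leNgt j1.
  exists j; first by rewrite mem_enum inE.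
  exists (e i0).
    split; last by exists (v i0); rewrite yj.
    by rewrite (ltW ei0)/= /e ltrBlDr.
  move=> i; rewrite -lerBlDl [X in X <= _](_ : _ = e i)// i0m/=.
  by have := v3 i0 i; rewrite -/(e i0); lra.
- move=> v x x' /gP[h1 h2 _] /gP[h3 h4 _]; apply: tcl => i.
  have P0 z : t i z = psum (t^~ z) i.+1 - psum (t^~ z) i.
    by rewrite psumS addrAC subrr add0r.
  have Pd (k : nat) : (k <= m)%N ->
      `|psum (t^~ x) k - psum (t^~ x') k| < 2%:R / N%:R.
    case: k => [|k] km.
      by rewrite !psum0//= subrr normr0 divr_gt0.
    pose kk : 'I_m := Ordinal km.
    rewrite ltr_pdivlMr// -(@ger0_norm _ N%:R)// -normrM mulrBl ![_ * N%:R]mulrC.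
    have := h1 kk; have := h2 kk; have := h3 kk; have := h4 kk; rewrite /y/=.
    set a := _ * _; set b := _ * _ => ? ? ? ?.
    by rewrite ltr_norml; apply/andP; split; lra.
  rewrite !P0; have := Pd _ (ltn_ord i); have := Pd _ (ltnW (ltn_ord i)).
  have -> : 2%:R / N%:R = (4%:R / N%:R) / 2%:R :> R by field; rewrite pnatr_eq0.
  move: Nc; set q := 4%:R / _; rewrite !ltr_norml => ? /andP[? ?] /andP[? ?].
  by apply/andP; split; lra.
Qed.

(** * Boxes in Z^k *)

Section boxes.
Context {k : nat}.
Implicit Types (a p : 'rV[int]_k) (M : nat).

Definition box_point a M (h : {ffun 'I_k -> 'I_M}) : 'rV[int]_k :=
  \row_i (a ord0 i + (h i : nat)%:Z).

Definition box a M : {fset 'rV[int]_k} :=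
  [fset box_point a h | h in {: {ffun 'I_k -> 'I_M}}]%fset.

Lemma box_point_inj a M : injective (@box_point a M).
Proof.
move=> h h' /rowP hh; apply/ffunP => i; apply/val_inj.
by have := hh i; rewrite !mxE => /addrI [].
Qed.

Lemma card_box a M : #|` box a M| = (M ^ k)%N.
Proof.
rewrite card_imfset; last exact: box_point_inj.
by rewrite -cardE card_ffun !card_ord.
Qed.

Lemma in_box a M p :
  (p \in box a M) = [forall i, (a ord0 i <= p ord0 i < a ord0 i + M%:Z)%R].
Proof.
apply/imfsetP/forallP => [[h _ ->] i|pa].
  by rewrite mxE lerDl lez_nat leq0n/= ltrD2l ltz_nat ltn_ord.
have hlt i : (`|p ord0 i - a ord0 i|%N < M)%N by have := pa i; lia.
exists [ffun i => Ordinal (hlt i)] => //.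
apply/rowP => i; rewrite mxE ffunE /= (_ : p 0 i = p ord0 i)//.
by have := pa i; lia.
Qed.

Lemma boxP a M p :
  reflect (forall i, (a ord0 i <= p ord0 i < a ord0 i + M%:Z)%R) (p \in box a M).
Proof. by rewrite in_box; exact: forallP. Qed.

Lemma boxNE N : boxN k N = [set` box 0 N].
Proof.
apply/seteqP; split => [p h|p /boxP h i]/=.
  by apply/boxP => i; rewrite mxE add0r; have [-> ->] := h i.
by have := h i; rewrite mxE add0r => /andP.
Qed.

End boxes.

Definition close_on {R : realType} {k : nat} {X : metricType R}
    (T : 'rV[int]_k -> X -> X) (Om : set 'rV[int]_k) (e : R) (x y : X) : Prop :=
  forall p, Om p -> mdist (T p x) (T p y) <= e.

Section pou_close.
Context {R : realType} {X : topologicalType}.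

Lemma pou_weaken (c1 c2 : X -> X -> Prop) (w1 w2 : nat) :
  (forall x y, c1 x y -> c2 x y) -> (w1 <= w2)%N ->
  @pou R X c1 w1 -> @pou R X c2 w2.
Proof.
move=> c12 w12 [n [psi [h1 h2 h3 h4 h5]]]; exists n, psi; split=> //.
  by move=> x; apply: leq_trans (h4 x) _.
by move=> v x y vx vy; apply/c12/(h5 v).
Qed.

Lemma pou_comp (Y : topologicalType) (c : Y -> Y -> Prop) (w : nat) (h : X -> Y) :
  continuous h -> @pou R Y c w -> @pou R X (fun x y => c (h x) (h y)) w.
Proof.
move=> hc [n [psi [h1 h2 h3 h4 h5]]]; exists n, (fun v x => psi v (h x)).
split=> //; last by move=> v x y; exact: h5.
by move=> v x; apply: (@continuous_comp _ _ _ h (psi v)); [exact: hc|exact: h1].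
Qed.

Lemma pou_trivial : @pou R X (fun _ _ => True) 0.
Proof.
exists 1%N, (fun _ _ => 1); split=> // [v|x|x].
- exact: cst_continuous.
- by rewrite big_ord_recl big_ord0 addr0.
- by apply: leq_trans (max_card _) _; rewrite card_ord.
Qed.

End pou_close.

Section pou_action.
Context {R : realType} {k : nat} {X : metricType R} (T : 'rV[int]_k -> X -> X).
Hypothesis actT : is_action T.

(** Subadditivity of the width: the translate at [a] is served by the pullback along [T a], and
    [pou_prod] adds the widths. *)
Lemma pou_cover (N w : nat) (Om : set 'rV[int]_k) (A : seq 'rV[int]_k) (e : R) :
  @pou R X (close_on T (boxN k N) e) w ->
  (forall p, Om p -> exists2 a, a \in A & p \in box a N) ->
  @pou R X (close_on T Om e) (size A * w).
Proof.
move=> pN OmA; have [T0 TD Tc] := actT.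
suff : @pou R X (fun x y => forall a p, a \in A -> p \in box a N ->
    mdist (T p x) (T p y) <= e) (size A * w).
  apply: pou_weaken => // x y xy p /OmA[a aA pa]; exact: xy pa.
elim: A {OmA} => [|a A IH]; first by apply: pou_weaken pou_trivial.
have h := pou_comp (Tc a) pN.
apply: pou_weaken (pou_prod h IH) => // x y [xy1 xy2] b p.
rewrite inE => /orP[/eqP -> pa|bA]; last exact: xy2.
have := xy1 (p - a); rewrite -!TD subrK; apply.
rewrite boxNE; apply/boxP => i; have /boxP/(_ i) := pa.
by rewrite !mxE add0r subr_ge0 ltrBlDl.
Qed.

End pou_action.

(** * Width dimension and partitions of unity *)

Lemma mdist_continuous {R : realType} (X : metricType R) :
  continuous (fun z : X * X => mdist z.1 z.2).
Proof.
move=> [x y]; apply/cvgrPdist_lt => e e0; near=> z => /=.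
have h1 : mdist x z.1 < e / 2.
  suff : ball x (e / 2) z.1 by rewrite ballEmdist.
  by near: z; apply: cvg_fst; apply: nbhsx_ballx; rewrite divr_gt0.
have h2 : mdist y z.2 < e / 2.
  suff : ball y (e / 2) z.2 by rewrite ballEmdist.
  by near: z; apply: cvg_snd; apply: nbhsx_ballx; rewrite divr_gt0.
have t1 := metric_triangle x z.1 y; have t2 := metric_triangle z.1 z.2 y.
have t3 := metric_triangle z.1 x z.2; have t4 := metric_triangle x y z.2.
rewrite (metric_sym z.2 y) in t2; rewrite (metric_sym z.1 x) in t3.
by rewrite ltr_norml; apply/andP; split; lra.
Unshelve. all: by end_near. Qed.

Lemma compact_lower_bound {R : realType} {Y : topologicalType} (f : Y -> R) :
  compact [set: Y] -> continuous f -> (forall y, 0 < f y) ->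
  exists2 c, 0 < c & forall y, c <= f y.
Proof.
move=> cY cf f0; have [[y0 _]|Y0] := pselect ([set: Y] !=set0); last first.
  by exists 1 => // y; exfalso; apply: Y0; exists y.
have [| |c _ cmin] := @compact_EVT_min Y R f setT _ cY.
- by exists y0.
- exact: continuous_subspaceT.
- by exists (f c) => // y; apply: cmin; rewrite inE.
Qed.

Section widim_pou.
Context {R : realType} {k : nat} {X : metricType R} (T : 'rV[int]_k -> X -> X).
Hypothesis cptX : compact [set: X].
Hypothesis actT : is_action T.

Lemma compactXX : compact [set: X * X].
Proof. by rewrite -setXTT; apply: compact_setX. Qed.

Lemma act_dist_continuous p : continuous (fun z : X * X => mdist (T p z.1) (T p z.2)).
Proof.
have [_ _ Tc] := actT; move=> z.
apply: (@continuous_comp _ _ _ (fun z : X * X => (T p z.1, T p z.2))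
  (fun z => mdist z.1 z.2)); last exact: mdist_continuous.
apply: cvg_pair.
  by apply: (@cvg_comp _ _ _ fst (T p)); [exact: cvg_fst|exact: Tc].
by apply: (@cvg_comp _ _ _ snd (T p)); [exact: cvg_snd|exact: Tc].
Qed.

Lemma mdist_bounded : exists B : R, forall x y : X, mdist x y <= B.
Proof.
(* A positive lower bound of [exp (- mdist)] is an upper bound of [mdist]. *)
have [| | |c c0 cle] := @compact_lower_bound R (X * X)%type (fun z => expR (- mdist z.1 z.2)).
- exact: compactXX.
- move=> z; apply: (@continuous_comp _ _ _ (fun z : X * X => - mdist z.1 z.2)).
    by apply: cvgN; exact: mdist_continuous.
  exact: continuous_expR.
- by move=> z; exact: expR_gt0.
exists (- ln c) => x y.
by rewrite lerNr -ler_expR lnK//; exact: cle (x, y).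
Qed.

Lemma dOmega_ge (Om : set 'rV[int]_k) p x y :
  Om p -> mdist (T p x) (T p y) <= dOmega T Om x y.
Proof.
move=> Omp; have [B Bx] := mdist_bounded; apply: sup_upper_bound.
  split; first by exists (mdist (T p x) (T p y)), p.
  by exists B => _ [q _ <-].
by exists p.
Qed.

Lemma dOmega_le (Om : set 'rV[int]_k) e x y :
  0 <= e -> close_on T Om e x y -> dOmega T Om x y <= e.
Proof.
move=> e0 xy; rewrite /dOmega.
have [[p Omp]|Om0] := pselect (Om !=set0).
  by apply: ge_sup; [exists (mdist (T p x) (T p y)), p|move=> _ [q Omq <-]; exact: xy].
rewrite (_ : [set _ | _ in Om] = set0) ?sup0//.
by apply/seteqP; split=> // r [q Omq _]; apply: Om0; exists q.
Qed.

Lemma diam_ge (Om : set 'rV[int]_k) (A : set X) x y :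
  A x -> A y -> dOmega T Om x y <= diam (dOmega T Om) A.
Proof.
move=> Ax Ay; have [B Bx] := mdist_bounded.
apply: sup_upper_bound; last by exists (x, y).
split; first by exists (dOmega T Om x y), (x, y).
exists (Num.max B 0) => _ [[u v] _ <-]; apply: dOmega_le => [|p _].
  by rewrite le_max lexx orbT.
by rewrite le_max Bx.
Qed.

Lemma diam_le (Om : set 'rV[int]_k) (A : set X) e :
  0 <= e -> (forall x y, A x -> A y -> close_on T Om e x y) ->
  diam (dOmega T Om) A <= e.
Proof.
move=> e0 Ae; have [[x Ax]|A0] := pselect (A !=set0).
  apply: ge_sup; first by exists (dOmega T Om x x), (x, x).
  by move=> _ [[u v] [/= Au Av] <-]; apply: dOmega_le => //; exact: Ae.
rewrite /diam (_ : [set _ | _ in _] = set0) ?sup0//.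
by apply/seteqP; split=> // r [[u v] [/= Au _] _]; apply: A0; exists u.
Qed.

(* By compactness the fibres of an [eps]-embedding remain [eps]-small when they
   are slightly thickened. *)
Lemma eps_embedding_thick (m : nat) (s : seq 'rV[int]_k) (f : X -> 'rV[R]_m) (eps : R) :
  continuous f -> eps_embedding (dOmega T [set` s]) eps f ->
  exists2 c, 0 < c & forall x y, (\sum_i `|f x ord0 i - f y ord0 i| < c) ->
    close_on T [set` s] (eps - c) x y.
Proof.
move=> fc fe.
have coordc i : continuous (fun x => f x ord0 i).
  move=> x; apply: (@continuous_comp _ _ _ f (fun M : 'rV[R]_m => M ord0 i)).
    exact: fc.
  exact: coord_continuous.
pose df (z : X * X) := \sum_i `|f z.1 ord0 i - f z.2 ord0 i|.
have dfc : continuous df.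
  apply: continuous_bigsum => i z; apply: cvg_norm; apply: cvgB.
    by apply: (@cvg_comp _ _ _ fst (fun x => f x ord0 i)); [exact: cvg_fst|exact: coordc].
  by apply: (@cvg_comp _ _ _ snd (fun x => f x ord0 i)); [exact: cvg_snd|exact: coordc].
have step p : p \in s -> exists2 c, 0 < c & forall x y, df (x, y) < c ->
    mdist (T p x) (T p y) <= eps - c.
  move=> ps.
  (* [H] is positive, since two points with [df = 0] lie in one fibre of [f] and are then less than
     [eps] apart. Below a positive lower bound of [H], smallness of [df] forces the second entry to
     be large. *)
  pose H z := Num.max (df z) (eps - mdist (T p z.1) (T p z.2)).
  have [| |[x y]|c c0 cH] := @compact_lower_bound R _ H.
  - exact: compactXX.
  - move=> z; apply: continuous_max; first exact: dfc.
    by apply: cvgB; [exact: cvg_cst|exact: act_dist_continuous].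
  - rewrite /H lt_max; case: (ltP 0 (df (x, y))) => //= df0.
    have /eqP : df (x, y) = 0.
      by apply/eqP; rewrite eq_le df0 sumr_ge0.
    rewrite psumr_eq0// => /allP fxy.
    rewrite subr_gt0; apply: le_lt_trans (fe (f x)).
    apply: (@le_trans _ _ (dOmega T [set` s] x y)); first exact: dOmega_ge.
    apply: diam_ge => //=; apply/rowP => i; apply/esym/eqP.
    by have := fxy i; rewrite mem_index_enum normr_eq0 subr_eq0; exact.
  exists c => // x y xyc; have := cH (x, y); rewrite /H le_max leNgt xyc/=.
  by lra.
have {step} : forall s' : seq 'rV[int]_k, {subset s' <= s} -> exists2 c, 0 < c &
    forall x y, df (x, y) < c -> close_on T [set` s'] (eps - c) x y.
  elim=> [|p s' IH] s's; first by exists 1.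
  have [|c1 c10 h1] := step p; first by apply: s's; rewrite mem_head.
  have [|c2 c20 h2] := IH; first by move=> q qs; apply: s's; rewrite inE qs orbT.
  exists (Num.min c1 c2); first by rewrite lt_min c10.
  move=> x y; rewrite lt_min => /andP[/h1 d1 /h2 d2] q /=.
  rewrite inE => /orP[/eqP ->|/d2 d3].
    by apply: (le_trans d1); rewrite lerB// ge_min lexx.
  by apply: (le_trans d3); rewrite lerB// ge_min lexx orbT.
by move=> /(_ s); apply.
Qed.

(** The barycentric coordinates of an [eps]-embedding have small fibres but possibly large supports,
    so they are refined by [pou_of_map]. Conversely, a partition of unity maps to the [w]-skeleton
    of a simplex. The margin [e < eps] reflects the strict inequality in [eps_embedding]. *)
Lemma widim_pouP (s : seq 'rV[int]_k) (eps : R) (w : nat) : 0 < eps ->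
  (widim (dOmega T [set` s]) eps <= w%:R%:E)%E <->
  exists2 e, e < eps & @pou R X (close_on T [set` s] e) w.
Proof.
move=> eps0; split=> [wle|[e eeps [n [psi [h1 h2 h3 h4 h5]]]]].
  have : (widim (dOmega T [set` s]) eps < w.+1%:R%:E)%E.
    by apply: le_lt_trans wle _; rewrite lte_fin ltr_nat.
  move=> /ereal_inf_lt[_ [m [K [[K0 K1] [f [fc fK fe]] ->]]]].
  rewrite lte_fin ltr_nat ltnS => Kw.
  have [c c0 cP] := eps_embedding_thick fc fe.
  exists (eps - c); first by rewrite ltrBlDr ltrDl.
  (* The sum of [m] differences below [c / (m + 1)] stays below [c], also for [m = 0]. *)
  apply: (@pou_of_map _ _ _ _ m (fun i x => f x ord0 i) (c / m.+1%:R)).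
  - move=> i x; apply: (@continuous_comp _ _ _ f (fun M : 'rV[R]_m => M ord0 i)).
      exact: fc.
    exact: coord_continuous.
  - by move=> i x; have [] := fK x.
  - by move=> x; have [_ []] := fK x.
  - move=> x; have [_ [_ xK]] := fK x.
    have := @leq_bigmax_cond _ (mem K) (fun s : {set 'I_m} => #|s|.-1) _ xK.
    rewrite -/(cdim K) cardsE; move: Kw; set a := cdim K; set b := #|_|.
    by move=> aw ba; rewrite (leq_trans (leqSpred b))// ltnS (leq_trans ba).
  - by rewrite divr_gt0.
  - move=> x y xy; apply: cP.
    apply: (@le_lt_trans _ _ (\sum_(i < m) c / m.+1%:R)).
      by apply: ler_sum => i _; exact: ltW.
    rewrite sumr_const card_ord -[ltLHS]mulr_natr -mulrA gtr_pMr//.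
    by rewrite mulrC ltr_pdivrMr ?ltr0n// mul1r ltr_nat.
pose K := [set A : {set 'I_n} | (0 < #|A| <= w.+1)%N]%SET.
apply: (@le_trans _ _ ((cdim K)%:R)%:E).
  apply: ereal_inf_lbound; exists n, K; split=> //.
    split=> [A|A B]; rewrite !inE => /andP[]// A0 Aw BA -> /=.
    exact: leq_trans (subset_leq_card BA) Aw.
  exists (fun x => \row_i psi i x); split.
  - move=> x; apply/cvg_ballP => r r0.
    have : \forall y \near x, forall i, ball (psi i x) r (psi i y).
      apply: filter_forall => i; have /cvg_ballP := h1 i x; exact.
    apply: filterS => y xy; split=> // i j; rewrite !mxE; exact: xy.
  - move=> x; split; first by move=> i; rewrite mxE.
    split; first by under eq_bigr do rewrite mxE.
    rewrite inE; apply/andP; split.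
      rewrite card_gt0; apply/eqP => /setP E; have /esym/eqP := h3 x.
      rewrite big1 ?oner_eq0// => i _; apply/eqP; have := E i.
      by rewrite !inE => /negbFE; rewrite mxE.
    apply: leq_trans (h4 x); apply: subset_leq_card.
    by apply/fintype.subsetP => i; rewrite !inE mxE.
  - move=> y; apply: (@le_lt_trans _ _ (Num.max e 0)); last by rewrite gt_max eeps.
    apply: diam_le; first by rewrite le_max lexx orbT.
    move=> u v /= uy vy p ps; rewrite le_max; apply/orP; left.
    have [i iu] : exists i, psi i u != 0.
      apply: contrapT => /forallNP E; have /esym/eqP := h3 u.
      rewrite big1 ?oner_eq0// => i _; apply/eqP.
      by have /negP := E i; rewrite negbK.
    apply: (h5 i) => //; have := congr1 (fun M : 'rV[R]_n => M ord0 i) vy.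
    by rewrite -uy !mxE => ->.
rewrite lee_fin ler_nat; apply/bigmax_leqP => A; rewrite inE => /andP[_].
by case: #|_|.
Qed.

End widim_pou.

(** * Mean dimension *)

Lemma natval_ereal_inf {R : realType} (S : set (\bar R)) :
  (forall e, S e -> exists w : nat, e = (w%:R%:E)) ->
  ereal_inf S = +oo%E \/ exists w : nat, ereal_inf S = w%:R%:E.
Proof.
move=> Snat; have [[e Se]|S0] := pselect (S !=set0); last first.
  left; rewrite (_ : S = set0) ?ereal_inf0//.
  by apply/seteqP; split=> // e Se; apply: S0; exists e.
right; have [w0 e0] := Snat _ Se.
have ex : exists w, `[< S (w%:R%:E) >] by exists w0; apply/asboolP; rewrite -e0.
case: (ex_minnP ex) => w /asboolP Sw wmin; exists w; apply/eqP.
rewrite eq_le ereal_inf_lbound//=; apply: le_ereal_inf_tmp => x Sx.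
have [w' ew'] := Snat _ Sx; rewrite ew' lee_fin ler_nat; apply: wmin.
by apply/asboolP; rewrite -ew'.
Qed.

(* Fekete's lemma for the averages of a nat-valued set function over boxes. *)
Lemma box_average_is_cvg {R : realType} (k : nat) (W : nat -> \bar R) :
  (forall N, W N = +oo%E \/ exists w : nat, W N = w%:R%:E) ->
  (forall M N w, (0 < M)%N -> (W M <= w%:R%:E)%E ->
    (W N <= (((N %/ M).+1 ^ k)%N * w)%:R%:E)%E) ->
  cvgn (fun N => W N * ((N ^ k)%:R^-1)%:E)%E.
Proof.
move=> Wnat Wsub.
(* One finite width makes all widths finite by [Wsub]; otherwise the averages are constantly
   infinite for positive [N]. *)
have [[M0 [M00 [w0 W0]]]|Winf] :=
    pselect (exists M, (0 < M)%N /\ exists w : nat, W M = w%:R%:E); last first.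
  apply/cvg_ex; exists +oo%E; apply: cvg_near_cst.
  exists 1%N => // N /= N0; have [->|[w Ww]] := Wnat N; last first.
    by exfalso; apply: Winf; exists N; split=> //; exists w.
  by rewrite gt0_mulye// lte_fin invr_gt0 ltr0n expn_gt0 N0.
have Wfin N : exists w : nat, W N = w%:R%:E.
  have [Woo|//] := Wnat N; have := Wsub M0 N w0 M00.
  by rewrite W0 lexx Woo => /(_ isT).
have [v vE] := choice Wfin.
pose b (N : nat) : R := (v N)%:R * (N ^ k)%:R^-1.
have bE N : (W N * ((N ^ k)%:R^-1)%:E)%E = (b N)%:E by rewrite vE.
under eq_fun do rewrite bE.
have b0 N : 0 <= b N by rewrite /b divr_ge0// ler0n.
pose B := [set b N | N in [set N | (0 < N)%N]].
have Binf : has_inf B.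
  split; first by exists (b 1%N), 1%N.
  by exists 0 => _ [N _ <-].
apply/cvg_ex; exists (inf B)%:E; apply: cvg_EFin; first exact: nearW.
apply/cvgrPdist_lt => e e0.
have [_ [M /= M0' <-] bM] := inf_adherent (divr_gt0 e0 (@ltr0n R 2)) Binf.
(* The bound tends to [b M] as [N] grows, and [b M] is within [e / 2] of the infimum. *)
have bN N : (0 < N)%N -> b N <= (1 + M%:R * N%:R^-1) ^+ k * b M.
  move=> N0; have := Wsub M N (v M) M0'.
  rewrite !vE lexx => /(_ isT); rewrite lee_fin ler_nat => vN.
  have Nk0 : 0 < (N ^ k)%:R :> R by rewrite ltr0n expn_gt0 N0.
  have Mk0 : 0 < (M ^ k)%:R :> R by rewrite ltr0n expn_gt0 M0'.
  have -> : 1 + M%:R * N%:R^-1 = (N + M)%:R / N%:R :> R.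
    by rewrite natrD mulrDl divff// pnatr_eq0 -lt0n.
  rewrite /b ler_pdivrMr// mulrAC expr_div_n -!natrX mulfVK ?gt_eqF//.
  rewrite mulrA ler_pdivlMr// -!natrM ler_nat.
  apply: (@leq_trans (((N %/ M).+1 ^ k * v M) * M ^ k)); first by rewrite leq_mul2r vN orbT.
  rewrite mulnAC -expnMn leq_mul2r; apply/orP; right.
  case: (posnP k) => [->//|k0]; rewrite leq_exp2r//.
  by rewrite mulSn addnC leq_add2r leq_divM.
have cvgb : (fun N : nat => (1 + M%:R * N.+1%:R^-1) ^+ k * b M) @ \oo --> b M.
  rewrite -[X in _ --> X]mul1r -[X in X * _](expr1n _ k).
  apply: cvgM; last exact: cvg_cst.
  apply: (@cvg_comp _ _ _ (fun N : nat => 1 + M%:R * N.+1%:R^-1 : R)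
    (fun x => x ^+ k) _ (nbhs (1 : R))); last exact: exprn_continuous.
  have -> : nbhs (1 : R) = nbhs (1 + M%:R * 0 : R) by rewrite mulr0 addr0.
  apply: cvgD; first exact: cvg_cst.
  apply: cvgM; first exact: cvg_cst.
  exact: cvg_harmonic.
have : \forall N \near \oo, (1 + M%:R * N.+1%:R^-1) ^+ k * b M < inf B + e.
  apply: (cvgr_lt _ cvgb); lra.
move=> [N0 _ N0P]; exists N0.+1 => // -[//|N] /= NN.
have hN := N0P N NN; have h2 := bN N.+1 isT.
have h3 : inf B <= b N.+1 by apply: ge_inf; [exact: Binf.2|exists N.+1].
by rewrite /= in hN; rewrite ltr_norml; apply/andP; split; lra.
Qed.

Section mdim_pou.
Context {R : realType} {k : nat} {X : metricType R} (T : 'rV[int]_k -> X -> X).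
Hypothesis k0 : (0 < k)%N.
Hypothesis cptX : compact [set: X].
Hypothesis actT : is_action T.

Let u eps N := (widim (dOmega T (boxN k N)) eps * ((N ^ k)%:R^-1)%:E)%E.

(** Needed to give [limn] in [mdim] its meaning. The box of side [N] is covered by [(N %/ M).+1 ^ k]
    grid boxes of side [M], with corners in [A]. *)
Lemma widim_average_is_cvg eps : 0 < eps -> cvgn (u eps).
Proof.
move=> eps0; apply: box_average_is_cvg.
  by move=> N; apply: natval_ereal_inf => _ [m [K [_ _ ->]]]; exists (cdim K).
move=> M N w M0; rewrite !boxNE => /(widim_pouP cptX actT _ _ eps0).
move=> [e eeps pM]; apply/(widim_pouP cptX actT _ _ eps0); exists e => //.
pose A := [seq \row_i ((h i : nat) * M)%:Z | h : {ffun 'I_k -> 'I_(N %/ M).+1}]%N.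
have <- : size A = ((N %/ M).+1 ^ k)%N.
  by rewrite size_map -cardE card_ffun !card_ord.
apply: (@pou_cover _ _ _ _ actT M); first by rewrite boxNE.
move=> p /boxP pN.
have hlt i : (`|p ord0 i|%N %/ M < (N %/ M).+1)%N.
  rewrite ltnS leq_div2r//; have := pN i; rewrite mxE add0r; lia.
exists (\row_i ((`|p ord0 i|%N %/ M) * M)%:Z)%N.
  apply/mapP; exists [ffun i => Ordinal (hlt i)]; first by rewrite mem_enum.
  by apply/rowP => i; rewrite !mxE ffunE.
apply/boxP => i; rewrite !mxE.
have := pN i; rewrite mxE add0r => /andP[p0 _].
have := divn_eq `|p ord0 i|%N M; have := ltn_pmod `|p ord0 i|%N M0.
by move: (_ %/ _)%N (_ %% _)%N => a b; lia.
Qed.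

Lemma widim_eps_le (Om : set 'rV[int]_k) eps1 eps2 : eps1 <= eps2 ->
  (widim (dOmega T Om) eps2 <= widim (dOmega T Om) eps1)%E.
Proof.
move=> e12; apply: ereal_inf_le_tmp => _ [m [K [K1 [f [f1 f2 f3]] ->]]].
exists m, K; split=> //; exists f; split=> // y.
exact: lt_le_trans (f3 y) e12.
Qed.

(** The limits grow as [eps] decreases, so the limit at [0^'+] is a supremum and dominates the limit
    at each [eps]. Hence some box already has average width below [D / 2]. *)
Lemma mdim_pou (D : nat) (eps : R) :
  (mdim T < (D%:R / 2)%:E)%E -> 0 < eps ->
  exists N w : nat, exists e : R, [/\ (0 < N)%N, (2 * w < D * N ^ k)%N, e < eps &
    @pou R X (close_on T (boxN k N) e) w].
Proof.
move=> mT eps0.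
have um e1 e2 : 0 < e1 -> e1 <= e2 -> (limn (u e2) <= limn (u e1))%E.
  move=> e10 e12; apply: lee_lim.
  - by apply: widim_average_is_cvg; exact: lt_le_trans e12.
  - exact: widim_average_is_cvg.
  - apply: nearW => N; apply: lee_wpmul2r; first by rewrite lee_fin invr_ge0 ler0n.
    exact: widim_eps_le.
have lim_le : (limn (u eps) <= mdim T)%E.
  have h0 : (BRight (0 : R) < BInfty R false)%O by [].
  have : (fun e => limn (u e)) x @[x --> (0:R)^'+] -->
      ereal_sup [set limn (u e) | e in [set` Interval (BRight (0:R)) (BInfty R false)]].
    apply: nonincreasing_at_right_cvge => // x y; rewrite !in_itv/= !andbT => x0 y0.
    exact: um.
  move=> /cvg_lim lE; have -> : mdim T = _ := lE (@ereal_hausdorff R).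
  apply: ereal_sup_ubound; exists eps => //.
  by rewrite /= in_itv/= eps0.
have : (limn (u eps) < (D%:R / 2)%:E)%E by exact: le_lt_trans mT.
have cu := widim_average_is_cvg eps0.
move=> lt; have [N0 _ N0P] := cu _ (open_nbhs_nbhs (conj
  (@open_ereal_lt_ereal R (D%:R / 2)%:E) lt)).
move: (N0P N0.+1 (leqnSn _)); rewrite /u /=; set N := N0.+1.
have Nk0 : 0 < (N ^ k)%:R :> R by rewrite ltr0n expn_gt0.
have [->|[w ww]] : widim (dOmega T (boxN k N)) eps = +oo%E \/
    exists w : nat, widim (dOmega T (boxN k N)) eps = w%:R%:E.
  by apply: natval_ereal_inf => _ [m [K [_ _ ->]]]; exists (cdim K).
  by rewrite gt0_mulye// lte_fin invr_gt0.
rewrite ww -EFinM lte_fin => wlt.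
have : (widim (dOmega T (boxN k N)) eps <= w%:R%:E)%E by rewrite ww.
rewrite boxNE => /(widim_pouP cptX actT _ _ eps0)[e eeps pe].
exists N, w, e; split=> //; last by rewrite boxNE.
rewrite -(ltr_nat R) !natrM -ltr_pdivrMr// -mulrA.
by rewrite mulrC -ltr_pdivlMr.
Qed.

End mdim_pou.

(** * General position *)

Lemma poly_nonroot_small {R : realType} (p : {poly R}) (t0 : R) :
  p != 0 -> 0 < t0 -> exists2 t, 0 < t <= t0 & ~~ root p t.
Proof.
move=> p0 t00; apply: contrapT => nex.
(* One candidate more than the degree of [p]. *)
pose s := [seq t0 / (i.+1)%:R | i <- iota 0 (size p)].
have := @max_poly_roots _ p s p0; rewrite size_map size_iota ltnn.
have -> : uniq s.
  rewrite map_inj_uniq ?iota_uniq// => i j /(mulfI (lt0r_neq0 t00)) /invr_inj /eqP.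
  by rewrite eqr_nat => /eqP [].
have -> : all (root p) s.
  apply/allP => _ /mapP[i _ ->]; apply: contrapT => /negP pi.
  apply: nex; exists (t0 / i.+1%:R) => //; rewrite divr_gt0 ?ltr0n//=.
  by rewrite ler_pdivrMr ?ltr0n// ler_peMr ?ler1n// ltW.
by move=> /(_ isT isT).
Qed.

(* Moving the points slightly towards a moment curve makes all Vandermonde-like
   minors nonzero, since these are polynomials in the displacement which do not
   vanish at displacement 1. *)
Lemma general_position {R : realType} (n M : nat) (a : 'I_n -> nat -> R) (d : R) :
  0 < d -> (forall v j, 0 <= a v j <= 1) ->
  exists u : 'I_n -> nat -> R, [/\ forall v j, 0 <= u v j <= 1,
    forall v j, `|u v j - a v j| <= d &
    forall c : 'I_n -> R, (#|[pred v | (c v != 0)%R]| <= M.+1)%N ->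
      \sum_v c v = 0 -> (forall j, (j < M)%N -> \sum_v c v * u v j = 0) ->
      forall v, c v = 0].
Proof.
move=> d0 a01.
pose t (v : 'I_n) : R := v.+1%:R / n.+1%:R.
have t01 v : 0 <= t v <= 1.
  rewrite divr_ge0//= ler_pdivrMr ?ltr0n// mul1r ler_nat ltnS.
  exact: ltnW (ltn_ord v).
have tinj : injective t.
  move=> v v' /(mulIf _); rewrite invr_eq0 pnatr_eq0 => /(_ isT) /eqP.
  by rewrite eqr_nat => /eqP [] /val_inj.
(* The extra coordinate 1 turns affine dependence ([\sum_v c v = 0]) into linear dependence; on the
   moment curve it is the power 0. *)
pose b v (j : nat) : R := if j is j'.+1 then a v j' else 1.
pose ent v (j : nat) : {poly R} := (1 - 'X) * (b v j)%:P + 'X * (t v ^+ j)%:P.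
have entE v j x : (ent v j).[x] = (1 - x) * b v j + x * t v ^+ j.
  by rewrite /ent !hornerE.
pose A s (h : {ffun 'I_s -> 'I_n}) : 'M[{poly R}]_s := \matrix_(i, j) ent (h i) j.
have detA s (h : {ffun 'I_s -> 'I_n}) x :
    (\det (A s h)).[x] = \det (\matrix_(i < s, j < s) (ent (h i) j).[x]).
  rewrite -horner_evalE -det_map_mx; congr (\det _).
  by apply/matrixP => i j; rewrite !mxE.
have detA0 s (h : {ffun 'I_s -> 'I_n}) : injective h -> \det (A s h) != 0.
  move=> hinj; apply/eqP => /(congr1 (fun p : {poly R} => p.[1])).
  rewrite detA horner0.
  have -> : (\matrix_(i < s, j < s) (ent (h i) j).[1]) =
      (Vandermonde s (\row_i t (h i)))^T.
    by apply/matrixP => i j; rewrite !mxE entE subrr mul0r add0r mul1r.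
  rewrite det_tr det_Vandermonde => /eqP.
  apply/negP; apply/prodf_neq0 => i _; apply/prodf_neq0 => j ij.
  rewrite !mxE subr_eq0; apply/eqP => /tinj /hinj ji.
  by rewrite ji ltnn in ij.
(* A single polynomial, so that one small displacement makes all minors of size at most [M + 1]
   nonzero. *)
pose P := \prod_(s < M.+2) \prod_(h : {ffun 'I_s -> 'I_n} | injectiveb h)
  \det (A s h).
have P0 : P != 0.
  apply/prodf_neq0 => s _; apply/prodf_neq0 => h /injectiveP; exact: detA0.
have md0 : 0 < Num.min d 1 by rewrite lt_min d0 ltr01.
have [x /andP[x0]] := poly_nonroot_small P0 md0.
rewrite le_min => /andP[xd x1] Px.
have tj01 v j : 0 <= t v ^+ j <= 1.
  by have /andP[? ?] := t01 v; rewrite exprn_ge0// exprn_ile1.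
exists (fun v j => (ent v j.+1).[x]); split.
- move=> v j; rewrite entE/=.
  have /andP[a0 a1] := a01 v j; have /andP[h0 h1] := tj01 v j.+1.
  by apply/andP; split; nra.
- move=> v j; rewrite entE/=.
  have /andP[a0 a1] := a01 v j; have /andP[h0 h1] := tj01 v j.+1.
  by rewrite ler_norml; apply/andP; split; nra.
move=> c cM c0 cu v; apply: contrapT => /eqP cv.
pose S := [set v | c v != 0]%SET.
have SM : (#|S| < M.+2)%N by rewrite cardsE.
pose h := [ffun i : 'I_#|S| => enum_val i].
have hinj : injective h by move=> i j; rewrite !ffunE; exact: enum_val_inj.
have : (\det (A _ h)).[x] != 0.
  move: Px; rewrite /root; apply: contraNneq => Ax0.
  rewrite /P horner_prod; apply/prodf_eq0.
  exists (Ordinal SM) => //; rewrite horner_prod; apply/prodf_eq0.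
  by exists h; [exact/injectiveP|exact/eqP].
rewrite detA; set B := \matrix_(_, _) _ => detB.
have Bu : B \in unitmx by rewrite unitmxE unitfE.
pose r : 'rV[R]_#|S| := \row_i c (enum_val i).
have rB : r *m B = 0.
  apply/rowP => j; rewrite !mxE.
  under eq_bigr do rewrite !mxE ffunE.
  rewrite -(big_enum_val (fun v => c v * (ent v j).[x]))/=.
  have -> : \sum_(v in S) c v * (ent v j).[x] = \sum_v c v * (ent v j).[x].
    rewrite [RHS](bigID (mem S))/= [X in _ = _ + X]big1 ?addr0// => w.
    by rewrite inE negbK => /eqP ->; rewrite mul0r.
  case: j => -[|j] jS /=; last by apply: cu; rewrite -ltnS (leq_trans jS).
  rewrite -[RHS]c0; apply: eq_bigr => w _.
  by rewrite entE/= expr0 !mulr1 subrK mulr1.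
have r0 : r = 0 by rewrite -(mulmxK Bu r) rB mul0mx.
have vS : v \in S by rewrite inE.
have := congr1 (fun M : 'rV_ _ => M ord0 (enum_rank_in vS v)) r0.
by rewrite !mxE enum_rankK_in// => /eqP; rewrite (negbTE cv).
Qed.

(** If [g] agrees at [x] and [y], the numbers [psi v x - psi v y] have sum 0 and are coefficients of
    a linear relation with at most [2 w + 2 <= #|I| + 1] terms. General position makes them vanish,
    so [x] and [y] share a support. The error is [d] for sampling [f] on a support and [d] for the
    displacement. *)
Lemma pou_perturb {R : realType} {X : topologicalType} (close : X -> X -> Prop)
    (w : nat) (I : finType) (f : I -> X -> R) (d : R) :
  @pou R X close w -> (2 * w < #|I|)%N -> 0 < d ->
  (forall i x, 0 <= f i x <= 1) ->
  (forall i x y, close x y -> `|f i x - f i y| <= d) ->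
  exists g : I -> X -> R, [/\ forall i, continuous (g i),
    forall i x, 0 <= g i x <= 1, forall i x, `|g i x - f i x| <= d + d &
    forall x y, (forall i, g i x = g i y) -> close x y].
Proof.
move=> [n [psi [psic psi0 psi1 psiw psicl]]] wI d0 f01 fd.
(* The vertex [v] receives the values of [f] at some point of its support, or 0 if the support is
   empty. *)
have /choice[a aP] : forall v : 'I_n, exists a : nat -> R,
    (forall j, 0 <= a j <= 1) /\
    forall x (i : I), psi v x != 0 -> `|a (enum_rank i) - f i x| <= d.
  move=> v; have [[x vx]|nx] := pselect (exists x, psi v x != 0); last first.
    exists (fun _ => 0); split=> [_|x i vx]; first by rewrite lexx ler01.
    by exfalso; apply: nx; exists x.
  exists (fun j => if insub j is Some i then f (enum_val (i : 'I_#|I|)) x else 0).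
  split=> [j|y i vy].
    by case: insubP => *; rewrite ?f01// lexx ler01.
  by rewrite valK enum_rankK; apply: fd; exact: (psicl v).
have [u [u01 ua ugen]] := @general_position R n #|I| a d d0 (fun v => (aP v).1).
pose g (i : I) x := \sum_v psi v x * u v (enum_rank i).
exists g; split.
- move=> i; apply: continuous_bigsum => v x.
  by apply: cvgM; [exact: psic|exact: cvg_cst].
- move=> i x; apply/andP; split.
    by apply: sumr_ge0 => v _; rewrite mulr_ge0//; case/andP: (u01 v (enum_rank i)).
  rewrite -(psi1 x); apply: ler_sum => v _; rewrite ler_piMr//.
  by case/andP: (u01 v (enum_rank i)).
- move=> i x.
  have -> : g i x - f i x = \sum_v psi v x * (u v (enum_rank i) - f i x).
    under eq_bigr do rewrite mulrBr.
    by rewrite sumrB -mulr_suml psi1 mul1r.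
  apply: le_trans (ler_norm_sum _ _ _) _.
  rewrite -[leRHS]mul1r -(psi1 x) mulr_suml; apply: ler_sum => v _.
  rewrite normrM ger0_norm//; have [->|vx] := eqVneq (psi v x) 0; first by rewrite !mul0r.
  rewrite ler_wpM2l//; apply: le_trans (ler_distD (a v (enum_rank i)) _ _) _.
  by rewrite lerD//; apply: (aP v).2.
move=> x y gxy.
have c0 : forall v, psi v x - psi v y = 0.
  apply: ugen.
  - have sub : [pred v | psi v x - psi v y != 0] \subset
        [predU [pred v | psi v x != 0] & [pred v | psi v y != 0]].
      apply/fintype.subsetP => v; rewrite !inE -negb_and; apply: contraNN.
      by move=> /andP[/eqP -> /eqP ->]; rewrite subrr.
    apply: leq_trans (subset_leq_card sub) _.
    have sU : (#|[predU [pred v | (psi v x != 0)%R] & [pred v | (psi v y != 0)%R]]| <=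
        w.+1 + w.+1)%N.
      apply: leq_trans (leq_add (psiw x) (psiw y)).
      by rewrite -cardUI leq_addr.
    by apply: leq_trans sU _; move: wI; lia.
  - by rewrite sumrB !psi1 subrr.
  - move=> j jI; under eq_bigr do rewrite mulrBl.
    rewrite sumrB; apply/eqP; rewrite subr_eq0; apply/eqP.
    by have := gxy (enum_val (Ordinal jI)); rewrite /g enum_valK.
have [v vx] : exists v, psi v x != 0.
  apply: contrapT => /forallNP E; have /esym/eqP := psi1 x.
  rewrite big1 ?oner_eq0// => i _; apply/eqP.
  by have /negP := E i; rewrite negbK.
apply: (psicl v) => //.
by move/eqP: (c0 v); rewrite subr_eq0 => /eqP <-.
Qed.

(** * Marker tilings of Z^k *)

(** One coordinate of the annulus argument in [tile_cover]: points less than [N] apart can be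
    separated by a cube only near its boundary. *)
Lemma inset_arith (L N : nat) (b p q : int) : (2 * N <= L)%N ->
  `|q - p| < N%:Z -> b + N%:Z <= q < b + N%:Z + (L - 2 * N)%N%:Z ->
  (b <= p < b + L%:Z) /\ (b <= q < b + L%:Z).
Proof. lia. Qed.

Lemma outset_arith (L N : nat) (b p q : int) :
  `|q - p| < N%:Z -> b <= p < b + L%:Z ->
  b - N%:Z <= q < b - N%:Z + (L + 2 * N)%N%:Z.
Proof. lia. Qed.

Section tiling.
Context {k : nat}.
Implicit Types (P : set 'rV[int]_k) (p c : 'rV[int]_k) (L N : nat).

Lemma rV_addE p c i : (p + c) ord0 i = p ord0 i + c ord0 i.
Proof. by rewrite mxE. Qed.

Lemma rV_oppE p i : (- p) ord0 i = - p ord0 i.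
Proof. by rewrite mxE. Qed.

Lemma rV_constE (x : int) i : (const_mx x : 'rV[int]_k) ord0 i = x.
Proof. by rewrite mxE. Qed.

Lemma rV_0E i : (0 : 'rV[int]_k) ord0 i = 0.
Proof. by rewrite mxE. Qed.

Lemma box_pointE p N (h : {ffun 'I_k -> 'I_N}) i :
  box_point p h ord0 i = p ord0 i + (h i : nat)%:Z.
Proof. by rewrite mxE. Qed.

Definition sparse P L := forall c c', P c -> P c' ->
  (forall i, `|c ord0 i - c' ord0 i| < L%:Z) -> c = c'.

Definition syndetic P L := forall p, exists2 c, P c &
  forall i, `|p ord0 i - c ord0 i| < L%:Z.

(** A marker within [L] of [p] may lie on either side of [p] in each coordinate; the [2 ^ k] shifted
    boxes around it take care of all sign patterns. *)
Definition offset L (e : {ffun 'I_k -> bool}) : 'rV[int]_k :=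
  \row_i (- (e i * L)%N%:Z).

Definition hit P L e p c := P c /\ p \in box (c + offset L e) L.

(** The zero offset is listed twice, so as to have index 0 whatever the order of the enumeration. *)
Definition offsets : seq {ffun 'I_k -> bool} :=
  [ffun=> false] :: enum {: {ffun 'I_k -> bool}}.

(* For a fixed [e] the boxes [c + offset L e + [L]], [c] in [P], are pairwise
   disjoint; a point belongs to the marker [c] whose box contains it for the first
   possible [e].  As [e = 0] comes first, [c] owns its whole box [c + [L]]. *)
Definition owned P L p c := exists j, [/\ (j < size offsets)%N,
  hit P L (nth [ffun=> false] offsets j) p c &
  forall j' c', (j' < j)%N -> ~ hit P L (nth [ffun=> false] offsets j') p c'].

Lemma hitE P L e p c : hit P L e p c <-> P c /\
  forall i, c ord0 i - (e i * L)%N%:Z <= p ord0 i < c ord0 i - (e i * L)%N%:Z + L%:Z.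
Proof.
split=> -[Pc h]; split=> //; first by move=> i; have /boxP/(_ i) := h;
  rewrite ?rV_addE ?rV_oppE ?rV_0E ?mxE.
by apply/boxP => i; rewrite ?rV_addE ?rV_oppE ?rV_0E ?mxE.
Qed.

Lemma hit_near P L e p c i : hit P L e p c -> `|p ord0 i - c ord0 i| <= L%:Z.
Proof.
by move=> /hitE[_ /(_ i)]; case: (e i) => /=; rewrite ?mul1n ?mul0n; lia.
Qed.

Lemma hit_inj P L e p c c' : sparse P L -> hit P L e p c -> hit P L e p c' -> c = c'.
Proof.
move=> sP /hitE[Pc h] /hitE[Pc' h']; apply: sP => // i.
by have := h i; have := h' i; lia.
Qed.

Lemma owned_near P L p c i : owned P L p c -> `|p ord0 i - c ord0 i| <= L%:Z.
Proof. by move=> [j [_ h _]]; exact: hit_near h. Qed.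

Lemma owned_marker P L p c : owned P L p c -> P c.
Proof. by move=> [j [_ [] ]]. Qed.

Lemma owned_inj P L p c c' : sparse P L -> owned P L p c -> owned P L p c' -> c = c'.
Proof.
move=> sP [j [js h hmin]] [j' [js' h' hmin']].
have jj' : j = j'.
  apply/eqP; rewrite eqn_leq; apply/andP; split; rewrite leqNgt; apply/negP => jj.
    exact: hmin jj h'.
  exact: hmin' jj h.
by rewrite -jj' in h'; exact: hit_inj h h'.
Qed.

Lemma owned_ex P L p : syndetic P L -> exists c, owned P L p c.
Proof.
move=> /(_ p)[c Pc pc].
pose e := [ffun i : 'I_k => (p ord0 i < c ord0 i)%R].
have he : hit P L e p c.
  by apply/hitE; split=> // i; rewrite ffunE; case: ltP => h; have := pc i;
    rewrite ?mul1n ?mul0n; lia.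
pose a e := `[< exists c, hit P L e p c >].
have ha : has a offsets.
  apply/hasP; exists e; first by rewrite inE mem_enum orbT.
  by apply/asboolP; exists c.
have /asboolP[c' hc'] := nth_find [ffun=> false] ha.
exists c', (find a offsets); split=> //; first by rewrite -has_find.
move=> j c'' jf hc''; have /asboolP := before_find [ffun=> false] jf.
by case; exists c''.
Qed.

(** Equivariance of the tiling: acting by [a] on the base point translates its marker set by
    [- a]. *)
Lemma owned_shift P L p c a :
  owned [set n | P (n + a)] L p c <-> owned P L (p + a) (c + a).
Proof.
have hE e q b : hit [set n | P (n + a)] L e q b <-> hit P L e (q + a) (b + a).
  by split=> /hitE[Pc h]; apply/hitE; split=> // i; have := h i; rewrite !rV_addE; lia.
split=> -[j [js h hmin]]; exists j; split=> //.
- exact/hE.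
- move=> j' c' jj hc'; apply: (hmin j' (c' - a) jj); apply/hE.
  by rewrite subrK.
- exact/hE.
- by move=> j' c' jj /hE; exact: hmin.
Qed.

(** Only markers within [L] of [p] are consulted. With clopen markers this makes the tiling locally
    constant in the base point. *)
Lemma owned_local P P' L p c :
  (forall q : 'rV[int]_k, (forall i, `|p ord0 i - q ord0 i| <= L%:Z) -> P q <-> P' q) ->
  owned P L p c -> owned P' L p c.
Proof.
move=> PP'.
have hE e q : hit P L e p q <-> hit P' L e p q.
  split=> h; have hn i := hit_near i h; case: h => Pq pq; split=> //;
  by apply/PP'.
move=> [j [js /hE h hmin]]; exists j; split=> // j' c' jj /hE; exact: hmin.
Qed.

Lemma owned_core P L p c : P c -> p \in box c L -> owned P L p c.
Proof.
move=> Pc pc; exists 0%N; split=> //; split=> //=.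
rewrite (_ : offset _ _ = 0) ?addr0//.
by apply/rowP => i; rewrite ?rV_addE ?rV_oppE ?rV_0E ?mxE ffunE mul0n oppr0.
Qed.

(** The shape of a tile relative to its marker, which sits at 0; [owned_near] confines it to
    [[-L, L]^k], so it is a finite set. *)
Definition tile P L : {fset 'rV[int]_k} :=
  [fset p in box (\row_i - L%:Z) (2 * L).+1 | `[< owned P L p 0 >]]%fset.

Lemma in_tile P L p : (p \in tile P L) <-> owned P L p 0.
Proof.
rewrite !inE /=; split=> [/andP[_ /asboolP]//|h]; apply/andP; split; last exact/asboolP.
apply/boxP => i; have := owned_near i h; rewrite ?rV_addE ?rV_oppE ?rV_0E ?mxE; lia.
Qed.

Lemma card_tile P L : P 0 -> (L ^ k <= #|` tile P L|)%N.
Proof.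
move=> P0; rewrite -(card_box (0 : 'rV[int]_k) L); apply: fsubset_leq_card.
by apply/fsubsetP => p p0; apply/in_tile; exact: owned_core.
Qed.

Lemma uniq_boxes N (s : seq 'rV[int]_k) : (0 < N)%N -> uniq s ->
  uniq [seq box_point (\row_i (z ord0 i * N%:Z)) h |
    z : 'rV[int]_k <- s, h : {ffun 'I_k -> 'I_N} <- enum {: {ffun 'I_k -> 'I_N}}].
Proof.
move=> N0 us; apply: allpairs_uniq => //; first exact: enum_uniq.
move=> [z h] [z' h'] _ _ /= E.
have zz : z = z'.
  apply/rowP => i; have /rowP/(_ i) := E; rewrite ?rV_addE ?rV_oppE ?rV_0E ?mxE.
  move=> /(congr1 (divz^~ N%:Z)).
  have Nn0 : N%:Z != 0 by lia.
  rewrite !divzMDl// !divz_small ?addr0//; first by rewrite ltz_nat ltn_ord.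
  by rewrite ltz_nat ltn_ord.
by rewrite -zz in E *; rewrite (box_point_inj E).
Qed.

(** The grid boxes of side [N] that meet the tile are disjoint. A point of them outside the tile is
    separated from a nearby tile point by some box of a marker, so it lies in an annulus around the
    boundary of that box. There are [2 ^ k] offsets and at most [6 ^ k] relevant markers, whence
    [12 ^ k] annuli. *)
Lemma tile_cover P L N : (0 < N)%N -> (2 * N <= L)%N -> sparse P L ->
  exists2 A : seq 'rV[int]_k,
    forall p, p \in tile P L -> exists2 a, a \in A & p \in box a N &
    (size A * N ^ k <= #|` tile P L| +
       12 ^ k * ((L + 2 * N) ^ k - (L - 2 * N) ^ k))%N.
Proof.
move=> N0 NL sP.
have L0 : (0 < L)%N by lia.
pose cell p : 'rV[int]_k := \row_i (p ord0 i %/ N%:Z)%Z.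
pose corner (z : 'rV[int]_k) : 'rV[int]_k := \row_i (z ord0 i * N%:Z).
have cellP p : p \in box (corner (cell p)) N.
  apply/boxP => i; rewrite ?rV_addE ?rV_oppE ?rV_0E ?mxE.
  have := divz_eq (p ord0 i) N%:Z; have := modz_ge0 (p ord0 i) (d := N%:Z).
  have := ltz_pmod (p ord0 i) (d := N%:Z); lia.
have cornerE z i : corner z ord0 i = z ord0 i * N%:Z by rewrite mxE.
pose s := undup [seq cell p | p <- enum_fset (tile P L)].
exists (map corner s).
  move=> p pt; exists (corner (cell p)) => //.
  by apply: map_f; rewrite mem_undup; apply: map_f.
(* The cubes indexed by [u] partition [[-3 L, 3 L)^k], and by sparsity each contains at most one
   marker; 0 is a default for those without one. *)
pose pickc (u : {ffun 'I_k -> 'I_6}) : 'rV[int]_k :=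
  xget 0 [set c | P c /\ c \in box (\row_i (((u i : nat)%:Z - 3) * L%:Z)) L].
pose ann (eu : {ffun 'I_k -> bool} * {ffun 'I_k -> 'I_6}) : {fset 'rV[int]_k} :=
  (box (pickc eu.2 + offset L eu.1 - const_mx N%:Z) (L + 2 * N) `\`
   box (pickc eu.2 + offset L eu.1 + const_mx N%:Z) (L - 2 * N))%fset.
have annE eu : #|` ann eu| = ((L + 2 * N) ^ k - (L - 2 * N) ^ k)%N.
  rewrite cardfsDS ?card_box//; apply/fsubsetP => p /boxP h; apply/boxP => i.
  by have := h i; rewrite ?rV_addE ?rV_oppE ?rV_0E ?mxE; lia.
pose S := [seq box_point (corner z) h | z <- s, h <- enum {: {ffun 'I_k -> 'I_N}}].
pose Q := enum_fset (tile P L) ++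
  flatten [seq enum_fset (ann eu) |
    eu <- enum {: {ffun 'I_k -> bool} * {ffun 'I_k -> 'I_6}}].
have sizeS : (size S = size (map corner s) * N ^ k)%N.
  by rewrite size_allpairs size_map -cardE card_ffun !card_ord.
have sizeQ : (size Q = #|` tile P L| +
    12 ^ k * ((L + 2 * N) ^ k - (L - 2 * N) ^ k))%N.
  rewrite size_cat size_flatten /shape -map_comp; congr (_ + _)%N.
  rewrite (_ : map _ _ = nseq (12 ^ k) ((L + 2 * N) ^ k - (L - 2 * N) ^ k)%N).
    by rewrite sumn_nseq mulnC.
  rewrite (_ : (12 ^ k)%N = size (enum {: {ffun 'I_k -> bool} * {ffun 'I_k -> 'I_6}})).
    by elim: (enum _) => //= eu r ->; congr (_ :: _); exact: annE.
  by rewrite -cardE card_prod !card_ffun card_bool !card_ord -expnMn.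
rewrite -sizeS -sizeQ; apply: uniq_leq_size.
  by apply: uniq_boxes => //; exact: undup_uniq.
move=> q /allpairsP[[z h] [/= zs _ qE]].
move: zs; rewrite mem_undup => /mapP[p pt zE].
have qp i : `|q ord0 i - p ord0 i| < N%:Z.
  have /boxP/(_ i) := cellP p; rewrite qE zE box_pointE !cornerE.
  move: (ltn_ord (h i)); move: (cell p ord0 i * _) (p ord0 i) (nat_of_ord (h i)) => C x y; lia.
rewrite mem_cat; have [//|qt] := boolP (q \in tile P L).
(* Ownership is determined by hits: if all hits of [p] and [q] agreed, [q] would belong to the tile
   as well. *)
have [e [c [Pc hn]]] : exists e c, P c /\
    ((p \in box (c + offset L e) L) != (q \in box (c + offset L e) L)).
  apply: contrapT => nex.
  have hE e c : hit P L e p c <-> hit P L e q c.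
    have E : P c -> (p \in box (c + offset L e) L) = (q \in box (c + offset L e) L).
      move=> Pc; apply/eqP; apply: contrapT => /negP hn; apply: nex.
      by exists e, c.
    by split=> -[Pc pc]; split=> //; rewrite ?E// -E.
  move/negP: qt; apply; apply/in_tile.
  have /in_tile[j [js hj hmin]] := pt; exists j; split=> //; first exact/hE.
  by move=> j' c' jj /hE; exact: hmin.
(* [p] is within [L] of 0, [q] within [N <= L / 2] of [p], and [c] within [L] of [p] or [q]. *)
have cn i : -3 * L%:Z <= c ord0 i < 3 * L%:Z.
  have pn : `|p ord0 i - 0| <= L%:Z.
    by have /in_tile ot := pt; have := owned_near i ot; rewrite rV_0E.
  have : `|p ord0 i - c ord0 i| <= L%:Z \/ `|q ord0 i - c ord0 i| <= L%:Z.
    move: hn; case pc : (p \in _) => /=; first by left; apply: (hit_near (P := P) (e := e)).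
    by case qc : (q \in _) => // _; right; apply: (hit_near (P := P) (e := e)).
  by have := qp i; lia.
have ult i : (`|((c ord0 i %/ L%:Z)%Z + 3)%R|%N < 6)%N.
  have := divz_eq (c ord0 i) L%:Z; have := modz_ge0 (c ord0 i) (d := L%:Z).
  have := ltz_pmod (c ord0 i) (d := L%:Z); have := cn i.
  move: (_ %/ _)%Z (_ %% _)%Z => x y; nia.
pose u := [ffun i => Ordinal (ult i)].
have cu : c \in box (\row_i (((u i : nat)%:Z - 3) * L%:Z)) L.
  apply/boxP => i; rewrite ?rV_addE ?rV_oppE ?rV_0E ?mxE !ffunE /=.
  have := divz_eq (c ord0 i) L%:Z; have := modz_ge0 (c ord0 i) (d := L%:Z).
  have := ltz_pmod (c ord0 i) (d := L%:Z); have := cn i.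
  move: (_ %/ _)%Z (_ %% _)%Z => x y; nia.
have pcu : pickc u = c.
  rewrite /pickc; case: xgetP => [c' _ [Pc' c'u]|/(_ c)]; last by case.
  apply: sP => // i; have /boxP/(_ i) := c'u; have /boxP/(_ i) := cu.
  by rewrite mxE; move: (_ * _) (c ord0 i) (c' ord0 i) => x1 x2 x3; lia.
apply/orP; right; apply/flattenP; exists (enum_fset (ann (e, u))).
  by apply: map_f; rewrite mem_enum.
have : q \in ann (e, u); last by [].
rewrite inE /= pcu; apply/andP; split.
  apply: contraNN hn => /boxP h1; apply/eqP.
  transitivity true; [|apply/esym]; apply/boxP => i; have := h1 i; have := qp i;
    by rewrite (rV_addE _ (const_mx _)) rV_constE => h2 h3; case: (inset_arith NL h2 h3).
move: hn; case pc : (p \in _) => /=.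
  move=> _; apply/boxP => i; have /boxP/(_ i) := pc; have := qp i.
  by rewrite (rV_addE _ (- const_mx _)) rV_oppE rV_constE; exact: outset_arith.
case qc : (q \in _) => // _; apply/boxP => i; have /boxP/(_ i) := qc.
rewrite (rV_addE _ (- const_mx _)) rV_oppE rV_constE.
by apply: (@outset_arith _ _ _ (q ord0 i)); rewrite subrr normr0 ltz_nat; exact: N0.
Qed.

End tiling.

(** The mean value bound [(x + d)^k - x^k <= k d (x + d)^(k - 1)], multiplied by [x + d] to avoid
    subtraction. *)
Lemma expn_gap (k x d : nat) :
  ((x + d) ^ k * (x + d) <= x ^ k * (x + d) + k * d * (x + d) ^ k)%N.
Proof.
elim: k => [|k IH]; first by rewrite !expn0 mul0n addn0.
have : (x ^ k <= (x + d) ^ k)%N.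
  by case: k {IH} => [//|k]; rewrite leq_exp2r// leq_addr.
rewrite !expnS; move: (x ^ k)%N ((x + d) ^ k)%N IH => a b IH ab.
have h1 : ((x + d) * (b * (x + d)) <= (x + d) * (a * (x + d) + k * d * b))%N.
  by rewrite leq_mul2l IH orbT.
have h2 : (d * a * (x + d) <= d * b * (x + d))%N by rewrite !leq_mul.
nia.
Qed.

Lemma boundary_negligible (k C : nat) : exists2 t, (2 <= t)%N &
  (C * ((t + 2) ^ k - (t - 2) ^ k) < t ^ k)%N.
Proof.
(* The gap between [t - 2] and [t + 2] is at most [4 k (t + 2)^k / (t + 2)], and
   [(t + 2)^k <= 2^k t^k] as [t >= 2]; so [t] has to exceed [C * 4 k * 2^k]. *)
pose t := (C * (k * 4 * 2 ^ k) + 2)%N; exists t; first by rewrite leq_addl.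
have t2 : (2 <= t)%N by rewrite leq_addl.
rewrite -(@ltn_pmul2r t); last by lia.
have := expn_gap k (t - 2) 4; rewrite (_ : t - 2 + 4 = t + 2)%N; last by lia.
have h1 : ((t + 2) ^ k <= 2 ^ k * t ^ k)%N.
  rewrite -expnMn; case: (k) => [//|k']; rewrite leq_exp2r//; lia.
have h2 : ((t - 2) ^ k <= (t + 2) ^ k)%N.
  by case: (k) => [//|k']; rewrite leq_exp2r//; lia.
have h3 : (0 < t ^ k)%N by rewrite expn_gt0; lia.
have tE : t = (C * (k * 4 * 2 ^ k) + 2)%N by [].
move: ((t - 2) ^ k)%N ((t + 2) ^ k)%N (t ^ k)%N (2 ^ k)%N h1 h2 h3 tE => a b c p.
move: t t2 => t t2 h1 h2 h3 tE gap.
have h4 : ((b - a) * t <= k * 4 * (p * c))%N.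
  apply: (@leq_trans ((b - a) * (t + 2))); first by rewrite leq_mul2l leq_addr orbT.
  apply: (@leq_trans (k * 4 * b)); first by rewrite mulnBl leq_subLR.
  by rewrite leq_mul2l h1 orbT.
rewrite -mulnA; apply: (@leq_ltn_trans (C * (k * 4 * (p * c)))).
  by rewrite leq_mul2l h4 orbT.
rewrite (_ : C * (k * 4 * (p * c)) = c * (C * (k * 4 * p)))%N; last by ring.
by rewrite ltn_pmul2l// tE; lia.
Qed.

(** Integrality gives [2 w <= D N^k - 1]. After multiplication by [N^k], this unit leaves room of
    about the size of the tile, which absorbs the boundary term once [L] is a large multiple of
    [N]. *)
Lemma efficient_tile_cover (k N w D : nat) : (0 < N)%N -> (2 * w < D * N ^ k)%N ->
  exists2 L, (0 < L)%N & forall P : set 'rV[int]_k, sparse P L -> P 0 ->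
    exists2 A : seq 'rV[int]_k,
      forall p, p \in tile P L -> exists2 a, a \in A & p \in box a N &
      (2 * (size A * w) < D * #|` tile P L|)%N.
Proof.
move=> N0 wD; have [t t2 tC] := boundary_negligible k (12 ^ k * D * N ^ k).
exists (t * N)%N; first by rewrite muln_gt0 N0 andbT; lia.
move=> P sP P0.
have [|A Acov Asize] := tile_cover N0 _ sP; first by rewrite leq_mul2r t2 orbT.
exists A => //.
have := card_tile (t * N) P0; move: Asize.
rewrite -mulnDl -mulnBl !expnMn -mulnBl.
have h0 : (0 < N ^ k)%N by rewrite expn_gt0 N0.
move: tC wD h0; move: (size A) (N ^ k)%N (#|` _|).
move: ((t + 2) ^ k - (t - 2) ^ k)%N (t ^ k)%N (12 ^ k)%N.
move=> e T B q n om tC wD n0 qn om0.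
rewrite -(@ltn_pmul2r n)// ltnNge; apply/negP => contra.
have h1 : (2 * w * (q * n) <= (D * n - 1) * (om + B * (e * n)))%N.
  by apply: leq_mul => //; lia.
have h2 : (D * n * (B * (e * n)) < om)%N.
  apply: leq_trans om0.
  rewrite (_ : D * n * (B * (e * n)) = (B * D * n * e) * n)%N; last by ring.
  by rewrite ltn_pmul2r.
have h3 : (D * om * n <= (D * n - 1) * (om + B * (e * n)))%N.
  apply: leq_trans contra _; apply: leq_trans h1.
  by rewrite leq_eqVlt; apply/orP; left; apply/eqP; ring.
move: h3; rewrite mulnBl mul1n mulnDr; nia.
Qed.

(** * Clopen markers *)

Lemma filter_forall_in {T : Type} {I : eqType} (F : set_system T) (s : seq I)
    (A : I -> set T) : Filter F ->
  (forall i, i \in s -> F (A i)) -> F [set t | forall i, i \in s -> A i t].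
Proof.
move=> FF; elim: s => [|i s IH] FA; first exact: filterE.
have Fi : F (A i) by apply: FA; rewrite mem_head.
have Fs : F [set t | forall j, j \in s -> A j t].
  by apply: IH => j js; apply: FA; rewrite inE js orbT.
apply: filterS2 Fi Fs => t Ait Ast j; rewrite inE => /orP[/eqP ->//|]; exact: Ast.
Qed.

Lemma compact_finite_cover {T : topologicalType} (f : T -> set T) :
  compact [set: T] -> (forall x, nbhs x (f x)) ->
  exists s : seq T, forall y, exists2 x, x \in s & f x y.
Proof.
move=> /compact_near_coveringP cT fx.
(* Finite lists directed by inclusion: a property holding eventually along this filter holds for
   some list. *)
pose F : set_system (seq T) := [set Q | exists s : seq T,
  forall s' : seq T, {subset s <= s'} -> Q s'].
have FF : Filter F.
  split; first by exists [::].
  - move=> Q Q' [s sQ] [s' sQ']; exists (s ++ s') => r sr; split.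
      by apply: sQ => x xs; apply: sr; rewrite mem_cat xs.
    by apply: sQ' => x xs; apply: sr; rewrite mem_cat xs orbT.
  - by move=> Q Q' QQ' [s sQ]; exists s => r /sQ /QQ'.
have [|s sP] := cT _ F (fun (s : seq T) y => exists2 x, x \in s & f x y) FF.
  move=> x _; exists (f x, [set s : seq T | x \in s]); last first.
    by move=> [y s] [/= fxy xs]; exists x.
  by split => //=; exists [:: x] => s; apply; rewrite inE.
by exists s => y; exact: sP.
Qed.

Section markers.
Context {R : realType} {k : nat} {Z : metricType R} (S : 'rV[int]_k -> Z -> Z).
Hypothesis cptZ : compact [set: Z].
Hypothesis actS : is_action S.
Hypothesis freeS : aperiodic S.
Hypothesis zdZ : zero_dim_basis Z.
Variable L : nat.
Hypothesis L0 : (0 < L)%N.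

Definition small_shift (n : 'rV[int]_k) := forall i, `|n ord0 i| < L%:Z.

Definition window : {fset 'rV[int]_k} := box (\row_i (1 - L%:Z)) (2 * L - 1).

Lemma windowP n : n \in window <-> small_shift n.
Proof.
by split=> [/boxP h i|h]; [|apply/boxP => i]; have := h i; rewrite mxE; lia.
Qed.

(** By freeness [z] differs from each of its finitely many translates by nonzero small shifts, and
    disjoint neighbourhoods separate them. *)
Lemma local_marker z : exists C : set Z, [/\ clopen C, C z &
  forall n y, small_shift n -> n != 0 -> C y -> ~ C (S n y)].
Proof.
have [S0 SD Sc] := actS.
have sep n : exists V : set Z, n != 0 ->
    [/\ nbhs z V & forall y, V y -> V (S n y) -> False].
  have [->|n0] := eqVneq n 0; first by exists setT.
  have zn : z != S n z by apply: contraNneq n0 => /esym/freeS ->.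
  have := @metric_hausdorff _ Z; rewrite open_hausdorff => /(_ _ _ zn).
  move=> [[A B] /= [/set_mem Az /set_mem Bz] [oA oB /eqP AB]].
  exists (A `&` S n @^-1` B) => _; split.
    apply: filterI; first exact: open_nbhs_nbhs.
    by apply: Sc; exact: open_nbhs_nbhs.
  move=> y [_ By] [Ay _].
  by have : (A `&` B) (S n y) by []; rewrite AB.
have [V VP] := choice sep.
have : nbhs z [set y | forall n, n \in window -> n != 0 -> V n y].
  apply: filter_forall_in => n _.
  have [->|n0] := eqVneq n 0; first by apply: filterE.
  by have [Vz _] := VP n n0; apply: filterS Vz => y Vy _.
rewrite nbhsE => -[U [oU Uz] UV]; have [C [cC Cz CU]] := zdZ oU Uz.
exists C; split=> // n y /windowP nw n0 Cy CSy.
have [_ /(_ y) h] := VP n n0; apply: h.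
  by have := UV _ (CU _ Cy); apply.
by have := UV _ (CU _ CSy); apply.
Qed.

(** Greedy choice along a finite cover by local markers: from each [U x], only the points not yet
    within a small shift of a marker are added. This keeps [C] clopen and sparse, while every point
    of [U x] gets a marker nearby. *)
Lemma clopen_marker : exists C : set Z, clopen C /\
  forall z, sparse [set n | C (S n z)] L /\ syndetic [set n | C (S n z)] L.
Proof.
have [S0 SD Sc] := actS.
have [U UP] := choice local_marker.
have [s sP] := @compact_finite_cover Z U cptZ (fun z =>
  let: And3 (conj oU _) Uz _ := UP z in open_nbhs_nbhs (conj oU Uz)).
have {sP} : forall y, exists2 x, x \in s & U x y by [].
suff : forall s : seq Z, exists C : set Z, [/\ clopen C,
    forall n y, small_shift n -> n != 0 -> C y -> ~ C (S n y) &
    forall x y, x \in s -> U x y -> exists2 n, small_shift n & C (S n y)].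
  move=> /(_ s)[C [cC Csep Ccov]] sP; exists C; split=> // z; split.
    move=> c c' Cc Cc' cc'; apply/eqP; rewrite -subr_eq0; apply: contrapT => /negP cn0.
    apply: (Csep (c - c') (S c' z)) => //; last by rewrite -SD subrK.
    by move=> i; rewrite !mxE; exact: cc'.
  move=> p; have [x xs Ux] := sP (S p z); have [n sn Cn] := Ccov x _ xs Ux.
  exists (n + p); first by rewrite /= SD.
  by move=> i; have := sn i; rewrite !mxE opprD addrCA subrr addr0 normrN.
elim=> [|x r [C [cC Csep Ccov]]]; first by exists set0; split=> //; exact: clopen0.
pose D := \bigcup_(n in [set` window]) (S n @^-1` C).
have cD : clopen D.
  rewrite /D bigcup_fset; apply: (big_ind (@clopen Z)) => [||n _].
  - exact: clopen0.
  - exact: clopenU.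
  - exact: preimage_clopen.
have [cU Ux Usep] := UP x.
have small0 : small_shift 0 by move=> i; rewrite mxE normr0; lia.
have smallN n : small_shift n -> small_shift (- n).
  by move=> sn i; rewrite mxE normrN; exact: sn.
exists (C `|` (U x `\` D)); split.
- by apply: clopenU => //; rewrite setDE; apply: clopenI => //; exact: clopenC.
- move=> n y sn n0 [Cy|[Uy Dy]] [CSy|[USy DSy]].
  + exact: Csep sn n0 Cy CSy.
  + apply: DSy; exists (- n); first exact/windowP/smallN.
    by rewrite /preimage/= -SD addNr S0.
  + by apply: Dy; exists n => //; exact/windowP.
  + exact: Usep sn n0 Uy USy.
- move=> x' y; rewrite inE => /orP[/eqP ->|xr] Uy; last first.
    by have [n sn Cn] := Ccov _ _ xr Uy; exists n => //; left.
  have [[n /windowP sn Cn]|Dy] := pselect (D y).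
    by exists n => //; left.
  by exists 0 => //; right; rewrite S0.
Qed.

End markers.

(** * Density *)

Lemma rV_continuous {R : realType} {X : topologicalType} (D : nat) (f : X -> 'rV[R]_D) :
  (forall i, continuous (fun x => f x ord0 i)) -> continuous f.
Proof.
move=> fc x; apply/cvg_ballP => r r0.
have : \forall y \near x, forall i, ball (f x ord0 i) r (f y ord0 i).
  by apply: filter_forall => i; have /cvg_ballP := fc i x; exact.
apply: filterS => y xy; split=> // i j; rewrite (ord1 i); exact: xy.
Qed.

Lemma rV_coord_continuous {R : realType} {X : topologicalType} (D : nat)
    (f : X -> 'rV[R]_D) i : continuous f -> continuous (fun x => f x ord0 i).
Proof.
move=> fc x; apply: (@continuous_comp _ _ _ f (fun M : 'rV[R]_D => M ord0 i)).
  exact: fc.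
exact: coord_continuous.
Qed.

Lemma compact_unif_continuous {R : realType} {X : metricType R} (D : nat)
    (f : X -> 'rV[R]_D) (d : R) :
  compact [set: X] -> continuous f -> 0 < d ->
  exists2 c, 0 < c & forall x y, mdist x y < c ->
    forall i, `|f x ord0 i - f y ord0 i| <= d.
Proof.
move=> cptX fc d0.
pose s (z : X * X) : R := \sum_i `|f z.1 ord0 i - f z.2 ord0 i|.
have sc : continuous s.
  apply: continuous_bigsum => i z; apply: cvg_norm; apply: cvgB.
    apply: (@cvg_comp _ _ _ fst (fun x => f x ord0 i)); first exact: cvg_fst.
    exact: rV_coord_continuous.
  apply: (@cvg_comp _ _ _ snd (fun x => f x ord0 i)); first exact: cvg_snd.
  exact: rV_coord_continuous.
(* Positive off the diagonal by the first entry and on it by the second, where [s = 0]. *)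
pose H (z : X * X) : R := Num.max (mdist z.1 z.2) (d - s z).
have [| |[x y]|c c0 cH] := @compact_lower_bound R _ H.
- exact: (compactXX cptX).
- move=> z; apply: (@continuous_max _ _ (fun z : X * X => mdist z.1 z.2) (fun z => d - s z)).
    exact: mdist_continuous.
  by apply: cvgB; [exact: cvg_cst|exact: sc].
- rewrite /H lt_max /= mdist_gt0; have [->/=|//] := eqVneq x y.
  by rewrite /s big1 ?subr0// => i _; rewrite subrr normr0.
exists c => // x y xyc i; have := cH (x, y).
rewrite /H le_max leNgt xyc/= => h.
have : `|f x ord0 i - f y ord0 i| <= s (x, y) by rewrite /s (bigD1 i)//= lerDl sumr_ge0.
lra.
Qed.

Section density.
Context {R : realType} {k D : nat} {X Z : metricType R}.
Variables (T : 'rV[int]_k -> X -> X) (S : 'rV[int]_k -> Z -> Z) (pi : X -> Z).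
Hypothesis k0 : (0 < k)%N.
Hypothesis cptX : compact [set: X].
Hypothesis actT : is_action T.
Hypothesis cptZ : compact [set: Z].
Hypothesis actS : is_action S.
Hypothesis freeS : aperiodic S.
Hypothesis zdZ : zero_dim_basis Z.
Hypothesis extpi : is_extension T S pi.
Hypothesis mdimT : (mdim T < (D%:R / 2)%:E)%E.

Lemma fset_perturb (f : X -> 'rV[R]_D) (d e : R) (w : nat) (Om : {fset 'rV[int]_k}) :
  continuous f -> (forall x i, 0 <= f x ord0 i <= 1) -> 0 < d ->
  (forall x y, mdist x y <= e -> forall i, `|f x ord0 i - f y ord0 i| <= d) ->
  @pou R X (close_on T [set` Om] e) w -> (2 * w < D * #|` Om|)%N ->
  exists G : 'rV[int]_k -> X -> 'rV[R]_D, [/\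
    forall p, continuous (G p), forall p x i, 0 <= G p x ord0 i <= 1,
    forall p x i, p \in Om -> `|G p x ord0 i - f (T p x) ord0 i| <= d + d &
    forall x y, (forall p, p \in Om -> G p x = G p y) -> close_on T [set` Om] e x y].
Proof.
move=> fc f01 d0 fd pO wO; have [T0 TD Tc] := actT.
pose I := (Om * 'I_D)%type : finType.
have [||||g [gc g01 gf ginj]] := @pou_perturb R X (close_on T [set` Om] e) w I
  (fun pi x => f (T (val pi.1) x) ord0 pi.2) d pO.
- by rewrite card_prod card_ord -cardfE (mulnC _ D).
- exact: d0.
- by move=> i x.
- by move=> [p i] x y xy /=; apply: fd; apply: xy; exact: (valP p).
(* Outside [Om] the value is 0, which makes [G] total in [p]. *)
exists (fun p x => \row_i if insub p is Some p' then g (p' : Om, i) x else 0); split.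
- move=> p; apply: rV_continuous => i; under eq_fun do rewrite mxE.
  case: insubP => [p' _ _|_]; [exact: gc|exact: cst_continuous].
- move=> p x i; rewrite mxE; case: insubP => [p' _ _|_]; first exact: g01.
  by rewrite lexx ler01.
- move=> p x i pO'; rewrite mxE insubT; exact: (gf (_, i)).
- move=> x y gxy; apply: ginj => -[p i].
  have /rowP/(_ i) := gxy (val p) (valP p).
  by rewrite !mxE valK.
Qed.

(** [base x] is the point of the orbit of [x] at the marker owning the origin, and [x] is recovered
    from it by the time [- cen (pi x)]. Evaluating [G] there at this time gives a map whose values
    on a whole tile are all the coordinates of [G] at one point. *)
Lemma dense_step (f : X -> 'rV[R]_D) (d eta : R) :
  continuous f -> (forall x i, 0 <= f x ord0 i <= 1) -> 0 < d -> 0 < eta ->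
  exists g : X -> 'rV[R]_D, [/\ continuous g, forall x i, 0 <= g x ord0 i <= 1,
    forall x i, `|g x ord0 i - f x ord0 i| <= d &
    forall x y, pi x = pi y -> (forall n, g (T n x) = g (T n y)) -> mdist x y < eta].
Proof.
move=> fc f01 d0 eta0.
have [T0 TD Tc] := actT; have [S0 SD Sc] := actS; have [pic _ piT] := extpi.
have d20 : 0 < d / 2 by rewrite divr_gt0.
have [c c0 fd] := compact_unif_continuous cptX fc d20.
(* [e < c] bounds the variation of [f] on the supports by [d / 2]; [e < eta] yields the final
   separation. *)
have eps0 : 0 < Num.min c eta by rewrite lt_min c0.
have [N [w [e [N0 wD]]]] := mdim_pou k0 cptX actT mdimT eps0.
rewrite lt_min => /andP[ec eeta] pN.
have [L L0 LP] := efficient_tile_cover N0 wD.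
have [C [cC CP]] := clopen_marker cptZ actS freeS zdZ L0.
pose M z : set 'rV[int]_k := [set n | C (S n z)].
have ME m z : M (S m z) = [set n | M z (n + m)].
  by apply/seteqP; split=> n; rewrite /M/= SD.
have /choice[G GP] : forall Om : {fset 'rV[int]_k},
    exists G : 'rV[int]_k -> X -> 'rV[R]_D,
    (exists2 z, C z & Om = tile (M z) L) -> [/\
    forall p, continuous (G p), forall p x i, 0 <= G p x ord0 i <= 1,
    forall p x i, p \in Om -> `|G p x ord0 i - f (T p x) ord0 i| <= d / 2 + d / 2 &
    forall x y, (forall p, p \in Om -> G p x = G p y) -> close_on T [set` Om] e x y].
  move=> Om; have [[z Cz ->]|nz] := pselect (exists2 z, C z & Om = tile (M z) L); last first.
    by exists (fun _ _ => 0) => h; exfalso; exact: nz.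
  have M0 : M z 0 by rewrite /M/= S0.
  have [A Acov Asize] := LP (M z) (CP z).1 M0.
  have pO : @pou R X (close_on T [set` tile (M z) L] e) (size A * w).
    by apply: (pou_cover actT pN) => p; exact: Acov.
  have [|G GP] := fset_perturb fc f01 d20 _ pO Asize.
    by move=> x y xy; apply: fd; exact: le_lt_trans ec.
  by exists G.
have /choice[cen cenP] : forall z, exists c, owned (M z) L 0 c.
  by move=> z; apply: owned_ex; exact: (CP z).2.
have cenC z : C (S (cen z) z) by exact: owned_marker (cenP z).
pose base x := T (cen (pi x)) x.
pose Om x := tile (M (pi (base x))) L.
have baseC x : C (pi (base x)) by rewrite /base piT.
have goodOm x : exists2 z, C z & Om x = tile (M z) L by exists (pi (base x)).
have cen_in x : - cen (pi x) \in Om x.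
  apply/in_tile; rewrite /base piT ME.
  by apply/owned_shift; rewrite addNr add0r.
pose g x := G (Om x) (- cen (pi x)) (base x).
have base_back x : T (- cen (pi x)) (base x) = x by rewrite /base -TD addNr T0.
exists g; split.
- move=> x.
  (* The marker lies within [L] of the origin, its tile within [2 L], and ownership looks [L]
     further. *)
  pose B : {fset 'rV[int]_k} := box (\row_i (- (3 * L)%N%:Z)) (6 * L).+1.
  have nB : \forall x' \near x, forall n, n \in B -> M (pi x) n <-> M (pi x') n.
    apply: filter_forall_in => n _.
    have cn : continuous (S n \o pi).
      by move=> y; apply: continuous_comp; [exact: pic|exact: Sc].
    have [oCn clCn] := preimage_clopen cC cn.
    have [Cx|Cx] := pselect (C (S n (pi x))).
      have : nbhs x ((S n \o pi) @^-1` C) by exact: open_nbhs_nbhs.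
      by apply: filterS => y Cy; split.
    have : nbhs x (~` ((S n \o pi) @^-1` C)).
      by apply: open_nbhs_nbhs; split=> //; exact: closed_openC.
    by apply: filterS => y Cy; split.
  have bnd x' : (forall n, n \in B -> M (pi x) n <-> M (pi x') n) ->
      g x' = G (Om x) (- cen (pi x)) (T (cen (pi x)) x').
    move=> agree.
    have cx i : `|cen (pi x) ord0 i| <= L%:Z.
      by have := owned_near i (cenP (pi x)); rewrite rV_0E sub0r normrN.
    have cE : cen (pi x') = cen (pi x).
      apply: (owned_inj (CP (pi x')).1 (cenP (pi x'))).
      apply: owned_local (cenP (pi x)) => q q0; apply: agree; apply/boxP => i.
      by have := q0 i; rewrite rV_0E mxE; lia.
    rewrite /g /base cE; congr (G _ _ _); rewrite /Om /base cE.
    apply/fsetP => p; rewrite !piT !ME; apply/idP/idP => /in_tile/owned_shift h;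
      apply/in_tile/owned_shift; apply: (owned_local _ h) => q qn;
      (have hn : q \in B by apply/boxP => i; have := qn i; have := cx i;
        have := owned_near i h; rewrite !rV_addE ?rV_0E mxE; lia);
      by split=> /(agree _ hn).
  have [Gc _ _ _] := GP _ (goodOm x).
  have Tg : continuous (fun x' => G (Om x) (- cen (pi x)) (T (cen (pi x)) x')).
    move=> y; apply: (@continuous_comp _ _ _ (T _) (G _ _)); [exact: Tc|exact: Gc].
  rewrite /continuous_at (bnd x); last by [].
  apply: cvg_trans (Tg x); apply: near_eq_cvg.
  by apply: filterS nB => x' /bnd.
- by move=> x i; have [_ G01 _ _] := GP _ (goodOm x); exact: G01.
- move=> x i; have [_ _ Gf _] := GP _ (goodOm x).
  have := Gf _ (base x) i (cen_in x); rewrite base_back -splitr; exact.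
move=> x y xy gxy; apply: le_lt_trans eeta.
have [_ _ _ Ginj] := GP _ (goodOm x).
have bE : pi (base x) = pi (base y) by rewrite /base !piT xy.
(* All points [T m u] with [m] in the tile have the base point [u], so [g] along the tile lists the
   coordinates of one map at [u]. *)
have gT u m : C (pi u) -> m \in tile (M (pi u)) L ->
    g (T m u) = G (tile (M (pi u)) L) m u.
  move=> Cu mO.
  have cE : cen (pi (T m u)) = - m.
    have h : owned (M (pi (T m u))) L 0 (- m).
      rewrite piT ME; apply/owned_shift.
      by rewrite add0r addNr; exact/in_tile.
    exact: owned_inj (CP _).1 (cenP _) h.
  by rewrite /g /Om /base cE opprK -TD addNr T0.
have : close_on T [set` Om x] e (base x) (base y).
  apply: Ginj => p pO; rewrite -(gT _ _ (baseC x) pO).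
  have -> : G (Om x) p (base y) = g (T p (base y)).
    by rewrite (gT _ _ (baseC y)) -bE.
  by rewrite /base -!TD xy; exact: gxy.
move=> /(_ _ (cen_in x)); rewrite base_back.
by rewrite xy base_back.
Qed.

End density.

(** * Baire category for cube-valued maps *)

Lemma nbhs_uniformP {R : realType} {X : choiceType} (D : nat)
    (f : {uniform X -> 'rV[R]_D}) (P : set {uniform X -> 'rV[R]_D}) :
  nbhs f P <-> exists2 r : R, 0 < r & forall h : {uniform X -> 'rV[R]_D},
    (forall x i, `|(f : X -> 'rV[R]_D) x ord0 i -
                   (h : X -> 'rV[R]_D) x ord0 i| < r) -> P h.
Proof.
split=> [/uniform_nbhs[E [/= entE EP]]|[r r0 rP]].
  move: entE; rewrite -entourage_ballE => -[r /= r0 rE].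
  exists r => // h hr; apply: EP => x _; apply: rE; split=> // i j.
  by rewrite (ord1 i); exact: hr.
apply/uniform_nbhs; exists [set xy | ball xy.1 r xy.2]; split.
  exact: (entourage_ball _ (PosNum r0)).
move=> h hr; apply: rP => x i; have [_] := hr x I.
by move=> /(_ ord0 i).
Qed.

Lemma hausdorff_sep (Y : topologicalType) :
  (forall p q : Y, p <> q -> exists (W : topologicalType) (phi : Y -> W),
    [/\ hausdorff_space W, continuous phi & phi p <> phi q]) ->
  hausdorff_space Y.
Proof.
move=> sepY p q pq; apply: contrapT => /sepY[W [phi [hW phic]]]; apply.
apply: hW => A B /(phic p) Ap /(phic q) Bq.
by have [y [Ay By]] := pq _ _ Ap Bq; exists (phi y).
Qed.

Section baire.
Context {R : realType} {X : metricType R} (D : nat).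
Implicit Types f g h : X -> 'rV[R]_D.

Definition cube_map f := continuous f /\ forall x i, 0 <= f x ord0 i <= 1.

Definition dist_le f g (r : R) := forall x i, `|f x ord0 i - g x ord0 i| <= r.

(** Nested closed balls with radii at least halved at each step, the new centre moving by at most
    half the old radius. The limit is uniform and the cube is closed, so the limit is again a cube
    map. *)
Lemma cube_maps_baire (U : nat -> set (X -> 'rV[R]_D)) :
  (forall n f, U n f -> exists2 r, 0 < r & forall h, dist_le f h r -> U n h) ->
  (forall n f r, cube_map f -> 0 < r ->
     exists g, [/\ cube_map g, U n g & dist_le f g r]) ->
  forall f r, cube_map f -> 0 < r ->
    exists h, [/\ cube_map h, forall n, U n h & dist_le f h r].
Proof.
move=> oU dU f0 r0 f0c r00.
have step : forall na : nat * ((X -> 'rV[R]_D) * R), exists b : (X -> 'rV[R]_D) * R,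
    cube_map na.2.1 -> 0 < na.2.2 ->
    [/\ cube_map b.1, 0 < b.2, b.2 <= na.2.2 / 2, dist_le na.2.1 b.1 (na.2.2 / 2) &
      forall h, dist_le b.1 h b.2 -> U na.1 h].
  move=> [n [f r]] /=.
  have [fc|] := pselect (cube_map f); last by exists (f, r).
  have [rr|] := ltP 0 r; last by exists (f, r).
  have r20 : 0 < r / 2 by rewrite divr_gt0.
  have [g [gc Ug fg]] := dU n f _ fc r20; have [s s0 sU] := oU n g Ug.
  exists (g, Num.min s (r / 2)) => _ _; split=> //=.
  - by rewrite lt_min s0.
  - by rewrite ge_min lexx orbT.
  - move=> h gh; apply: sU => x i; apply: le_trans (gh x i) _.
    by rewrite ge_min lexx.
have [F FP] := choice step.
pose st := fix st n := if n is m.+1 then F (m, st m) else (f0, r0).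
have stP n : cube_map (st n).1 /\ 0 < (st n).2.
  by elim: n => [//|n [h1 h2]] /=; have [] := FP (n, st n) h1 h2.
have stS n : [/\ (st n.+1).2 <= (st n).2 / 2,
    dist_le (st n).1 (st n.+1).1 ((st n).2 / 2) &
    forall h, dist_le (st n.+1).1 h (st n.+1).2 -> U n h].
  by have [h1 h2] := stP n; have [] := FP (n, st n) h1 h2.
have nest n m : (n <= m)%N -> forall h, dist_le (st m).1 h (st m).2 ->
    dist_le (st n).1 h (st n).2.
  elim: m => [|m IH]; first by rewrite leqn0 => /eqP ->.
  rewrite leq_eqVlt => /orP[/eqP -> //|]; rewrite ltnS => nm h hm; apply: IH => // x i.
  have [h1 h2 _] := stS m; have := h2 x i; have := hm x i.
  have := ler_distD ((st m.+1).1 x ord0 i) ((st m).1 x ord0 i) (h x ord0 i).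
  by lra.
have rn n : (st n).2 <= r0 / n.+1%:R.
  elim: n => [|n IH]; first by rewrite divr1.
  have [h1 _ _] := stS n; apply: le_trans h1 _.
  apply: (@le_trans _ _ (r0 / n.+1%:R / 2)); first by rewrite ler_pM2r ?invr_gt0.
  rewrite -mulrA -invfM -natrM ler_pM2l// lef_pV2 ?posrE ?ltr0n// ler_nat.
  lia.
have self n : dist_le (st n).1 (st n).1 (st n).2.
  by move=> x i; rewrite subrr normr0 ltW//; exact: (stP n).2.
(* Left endpoints of the nested intervals; their supremum lies in every interval. *)
pose E x (i : 'I_D) : set R := [set (st n).1 x ord0 i - (st n).2 | n in [set: nat]].
have Eub x i m : ubound (E x i) ((st m).1 x ord0 i + (st m).2).
  move=> _ [n _ <-].
  have a : `|(st n).1 x ord0 i - (st (maxn n m)).1 x ord0 i| <= (st n).2.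
    exact: (nest n _ (leq_maxl _ _) _ (self _)).
  have b : `|(st m).1 x ord0 i - (st (maxn n m)).1 x ord0 i| <= (st m).2.
    exact: (nest m _ (leq_maxr _ _) _ (self _)).
  move: a b; rewrite !ler_norml => /andP[? ?] /andP[? ?]; lra.
pose h x : 'rV[R]_D := \row_i sup (E x i).
have hst n : dist_le (st n).1 h (st n).2.
  move=> x i; rewrite mxE ler_norml; apply/andP; split.
    have : sup (E x i) <= (st n).1 x ord0 i + (st n).2.
      by apply: ge_sup; [exists ((st 0%N).1 x ord0 i - (st 0%N).2), 0%N|exact: Eub].
    by lra.
  have : (st n).1 x ord0 i - (st n).2 <= sup (E x i).
    apply: sup_upper_bound; last by exists n.
    split; first by exists ((st 0%N).1 x ord0 i - (st 0%N).2), 0%N.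
    by exists ((st 0%N).1 x ord0 i + (st 0%N).2); exact: Eub.
  by lra.
have hsmall e : 0 < e -> exists2 n, dist_le (st n).1 h e & cube_map (st n).1.
  move=> e0; exists (Num.truncn (r0 / e)); last exact: (stP _).1.
  move=> x i; apply: le_trans (hst _ x i) _; apply: le_trans (rn _) _.
  by rewrite ler_pdivrMr ?ltr0n// mulrC -ler_pdivrMr// ltW// truncnS_gt.
exists h; split.
- split.
    apply: rV_continuous => i x; apply/cvgrPdist_lt => e e0.
    have e30 : 0 < e / 3 by rewrite divr_gt0.
    have [n hn [stc _]] := hsmall _ e30.
    have := @rV_coord_continuous _ _ _ _ i stc x => /cvgrPdist_lt/(_ _ e30).
    apply: filterS => y xy; have := hn x i; have := hn y i; move: xy.
    rewrite !ltr_norml !ler_norml => /andP[? ?] /andP[? ?] /andP[? ?].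
    by apply/andP; split; lra.
  move=> x i; apply/andP; split; apply/ler_addgt0Pl => e e0;
    have [n hn [_ st01]] := hsmall _ e0; have /andP[? ?] := st01 x i;
    have := hn x i; rewrite ler_norml => /andP[? ?]; lra.
- by move=> n; have [_ _] := stS n; apply; exact: hst.
- exact: (hst 0%N).
Qed.

End baire.

(** * Separation of orbits *)

Section separating.
Context {R : realType} {k D : nat} {X Z : metricType R}.
Variables (T : 'rV[int]_k -> X -> X) (S : 'rV[int]_k -> Z -> Z) (pi : X -> Z).
Hypothesis cptX : compact [set: X].
Hypothesis actT : is_action T.
Hypothesis pic : continuous pi.

(* Being uniform over a finite set of times and with a margin makes the
   condition manifestly open; compactness shows that nothing is lost. *)
Definition separating (eta : R) (f : X -> 'rV[R]_D) :=
  exists d : R, exists s : seq 'rV[int]_k, 0 < d /\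
    forall x y, pi x = pi y -> eta <= mdist x y ->
      exists p i, p \in s /\ d < `|f (T p x) ord0 i - f (T p y) ord0 i|.

Lemma separating_open eta f : separating eta f ->
  exists2 r, 0 < r & forall h, dist_le f h r -> separating eta h.
Proof.
(* Both values move by at most [d / 4], so a gap above [d] stays above [d / 2]. *)
move=> [d [s [d0 sP]]]; exists (d / 4); first by rewrite divr_gt0.
move=> h fh; exists (d / 4), s; split; first by rewrite divr_gt0.
move=> x y xy exy; have [p [i [ps dlt]]] := sP x y xy exy.
exists p, i; split=> //; have h1 := fh (T p x) i; have h2 := fh (T p y) i.
have h3 := ler_distD (h (T p x) ord0 i) (f (T p x) ord0 i) (f (T p y) ord0 i).
have h4 := ler_distD (h (T p y) ord0 i) (h (T p x) ord0 i) (f (T p y) ord0 i).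
by rewrite (distrC (h (T p y) ord0 i)) in h4; lra.
Qed.

Lemma separatingP eta f : continuous f -> 0 < eta ->
  (forall x y, pi x = pi y -> (forall n, f (T n x) = f (T n y)) ->
    mdist x y < eta) ->
  separating eta f.
Proof.
move=> fc eta0 fP; have [T0 TD Tc] := actT.
pose df p i (z : X * X) : R := `|f (T p z.1) ord0 i - f (T p z.2) ord0 i|.
have dfc p i : continuous (df p i).
  have cp : continuous (fun x => f (T p x) ord0 i).
    apply: rV_coord_continuous => x.
    by apply: (@continuous_comp _ _ _ (T p) f); [exact: Tc|exact: fc].
  move=> z; apply: cvg_norm; apply: cvgB.
    by apply: (@cvg_comp _ _ _ fst (fun x => f (T p x) ord0 i)); [exact: cvg_fst|exact: cp].
  by apply: (@cvg_comp _ _ _ snd (fun x => f (T p x) ord0 i)); [exact: cvg_snd|exact: cp].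
pose dpi (z : X * X) : R := mdist (pi z.1) (pi z.2).
have dpic : continuous dpi.
  move=> z; apply: (@continuous_comp _ _ _ (fun z : X * X => (pi z.1, pi z.2))
    (fun z : Z * Z => mdist z.1 z.2)); last exact: mdist_continuous.
  apply: cvg_pair.
    by apply: (@cvg_comp _ _ _ fst pi); [exact: cvg_fst|exact: pic].
  by apply: (@cvg_comp _ _ _ snd pi); [exact: cvg_snd|exact: pic].
(* Near a pair in different fibres, or at distance below [eta], the condition is void and [(1, 0)]
   is a dummy; otherwise some coordinate difference is positive and at least half of it persists
   nearby. *)
have loc (z : X * X) : exists dp : R * 'rV[int]_k, 0 < dp.1 /\
    nbhs z [set z' : X * X | pi z'.1 = pi z'.2 -> eta <= mdist z'.1 z'.2 ->
      exists i, dp.1 < df dp.2 i z'].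
  have [piz|piz] := eqVneq (pi z.1) (pi z.2); last first.
    exists (1, 0); split=> //.
    have : 0 < dpi z by rewrite mdist_gt0.
    move=> /(cvgr_gt _ (dpic z)); apply: filterS => z' /= h zE.
    by move: h; rewrite /dpi zE mdistxx ltxx.
  have [eta_le|eta_gt] := leP eta (mdist z.1 z.2); last first.
    exists (1, 0); split=> //.
    move: eta_gt => /(cvgr_lt _ (@mdist_continuous _ _ z)).
    by apply: filterS => z' /= h _; rewrite leNgt h.
  have [p [i pi0]] : exists p i, df p i z != 0.
    apply: contrapT => nex.
    have := fP z.1 z.2 piz; rewrite ltNge eta_le => /(_ _)/negP; apply => //.
    move=> n; apply/rowP => i; apply/eqP; rewrite -subr_eq0 -normr_eq0.
    apply: contrapT => /negP h; apply: nex; exists n, i; exact: h.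
  have df0 : 0 < df p i z by rewrite lt_neqAle eq_sym pi0 normr_ge0.
  exists (df p i z / 2, p); split=> /=; first by rewrite divr_gt0.
  have : df p i z / 2 < df p i z by lra.
  move=> /(cvgr_gt _ (dfc p i z)); apply: filterS => z' h _ _; by exists i.
have /choice[dp dpP] := loc.
have [s sP] := compact_finite_cover (compactXX cptX) (fun z => (dpP z).2).
exists (\big[Num.min/1]_(z <- s) (dp z).1), [seq (dp z).2 | z <- s]; split.
  elim: s {sP} => [|z s IH]; first by rewrite big_nil.
  by rewrite big_cons lt_min IH (dpP z).1.
move=> x y xy exy; have [z zs /(_ xy exy)[i zi]] := sP (x, y).
exists (dp z).2, i; split; first exact: map_f.
apply: le_lt_trans zi.
elim: s zs {sP} => [//|z' s IH]; rewrite inE big_cons ge_min.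
by move=> /orP[/eqP ->|/IH ->]; rewrite ?lexx// orbT.
Qed.

Lemma separating_inj f : (forall n : nat, separating n.+1%:R^-1 f) ->
  injective (fun x => (Iorbit T f x, pi x)).
Proof.
move=> fs x y [fxy pxy]; apply: contrapT => /eqP; rewrite -mdist_gt0 => xy0.
have [d [s [d0 sP]]] := fs (Num.truncn (mdist x y)^-1).
have [|p [i [_]]] := sP x y pxy.
  by rewrite -[leRHS]invrK lef_pV2 ?posrE ?invr_gt0 ?ltr0n// ltW// truncnS_gt.
have := congr1 (fun F : 'rV[int]_k -> 'rV[R]_D => F p) fxy; rewrite /Iorbit => ->.
by rewrite subrr normr0 ltNge ltW.
Qed.

Lemma orbit_map_continuous (f : X -> 'rV[R]_D) : continuous f ->
  continuous (fun x : X =>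
    ((Iorbit T f x : {ptws 'rV[int]_k -> 'rV[R]_D}), pi x)).
Proof.
move=> fc; have [T0 TD Tc] := actT.
have h1 : continuous (fun x => Iorbit T f x : {ptws 'rV[int]_k -> 'rV[R]_D}).
  move=> x; apply/cvg_sup => n; apply/cvg_image.
    by apply/seteqP; split=> // v _; exists (fun=> v).
  move=> A /= An.
  have := @continuous_comp _ _ _ (T n) f x (Tc n x) (fc (T n x)) A An => h.
  exists (fun w : 'rV[int]_k -> 'rV[R]_D => A (w n)) => //.
  by apply/seteqP; split=> [v [w Aw <-]//|v Av]; exists (fun=> v).
by move=> x; exact: (cvg_pair (h1 x) (@pic x)).
Qed.

Lemma orbit_target_hausdorff :
  hausdorff_space ({ptws 'rV[int]_k -> 'rV[R]_D} * Z)%type.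
Proof.
apply: hausdorff_sep => -[u z] [u' z'] neq.
have [zz|/eqP zz] := eqVneq z z'; last first.
  exists Z, snd; split=> //; first exact: metric_hausdorff.
  by move=> p; exact: cvg_snd.
have [n [i ni]] : exists n i, u n ord0 i <> u' n ord0 i.
  apply: contrapT => nex; apply: neq; rewrite zz; congr pair.
  apply/funext => n; apply/rowP => i; apply: contrapT => h; apply: nex.
  by exists n, i.
exists R, (fun w : {ptws 'rV[int]_k -> 'rV[R]_D} * Z => w.1 n ord0 i); split=> //.
apply: rV_coord_continuous => w.
apply: (@cvg_comp _ _ _ fst (fun v : {ptws 'rV[int]_k -> 'rV[R]_D} => v n)).
    exact: cvg_fst.
exact: (@proj_continuous _ (fun=> 'rV[R]_D) n).
Qed.

Lemma separating_embedding (f : X -> 'rV[R]_D) : continuous f ->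
  (forall n : nat, separating n.+1%:R^-1 f) ->
  top_embedding (fun x : X =>
    ((Iorbit T f x : {ptws 'rV[int]_k -> 'rV[R]_D}), pi x)).
Proof.
move=> fc fs.
have hinj : injective (fun x : X =>
    ((Iorbit T f x : {ptws 'rV[int]_k -> 'rV[R]_D}), pi x)).
  exact: separating_inj.
have hc := orbit_map_continuous fc.
move: hinj hc; set h := (fun x : X => _) => hinj hc; split=> // U oU.
exists (~` (h @` (~` U))); split.
  apply: closed_openC; apply: compact_closed; first exact: orbit_target_hausdorff.
  apply: continuous_compact; first exact: continuous_subspaceT.
  by apply: (subclosed_compact _ cptX) => //; exact: open_closedC.
apply/seteqP; split=> [_ [x Ux <-]|_ [[x _ <-] hx]].
  split; first by exists x.
  by move=> [x' nUx' /hinj xx']; apply: nUx'; rewrite xx'.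
by exists x => //; apply: contrapT => nUx; apply: hx; exists x.
Qed.

End separating.

Unset Implicit Arguments.

Theorem theorem3p1 (R : realType) (k D : nat) (X Z : metricType R)
    (T : 'rV[int]_k -> X -> X) (S : 'rV[int]_k -> Z -> Z) (pi : X -> Z) :
  (0 < k)%N -> (0 < D)%N ->
  compact [set: X] -> is_action T ->
  compact [set: Z] -> is_action S -> aperiodic S -> zero_dim_basis Z ->
  is_extension T S pi ->
  (mdim T < (D%:R / 2)%:E)%E ->
  exists G : set {uniform X -> 'rV[R]_D},
    dense_Gdelta_in (cube_maps R D X) G /\
    forall f, G f ->
      top_embedding (fun x : X =>
        ((Iorbit T (f : X -> 'rV[R]_D) x : {ptws 'rV[int]_k -> 'rV[R]_D}), pi x)).
Proof.
move=> k0 _ cptX actT cptZ actS freeS zdZ extpi mdimT.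
have [pic _ _] := extpi.
pose U (n : nat) : set {uniform X -> 'rV[R]_D} :=
  [set f | separating T pi n.+1%:R^-1 (f : X -> 'rV[R]_D)].
exists (cube_maps R D X `&` \bigcap_n U n); split; last first.
  move=> f [[fc _] fU]; apply: (separating_embedding cptX actT pic fc) => n.
  exact: fU.
split; first by move=> f [].
- move=> f [fc f01] B /nbhs_uniformP[r r0 rB].
  (* Half the radius, since neighbourhoods ask for strict inequalities while [dist_le] is not
     strict. *)
  have r20 : 0 < r / 2 by rewrite divr_gt0.
  have [||h [hc hU hf]] := @cube_maps_baire R X D (fun n => separating T pi n.+1%:R^-1)
      _ _ f (r / 2) (conj fc f01) r20.
  + by move=> n g; exact: separating_open.
  + move=> n g e [gc g01] e0.
    have n0 : 0 < n.+1%:R^-1 :> R by rewrite invr_gt0.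
    have [g' [gc' g01' gg' gsep]] :=
      dense_step k0 cptX actT cptZ actS freeS zdZ extpi mdimT gc g01 e0 n0.
    exists g'; split=> //; first exact: separatingP.
    by move=> x i; rewrite distrC; exact: gg'.
  + exists h; split; last first.
      by apply: rB => x i; apply: le_lt_trans (hf x i) _; lra.
    by split=> [|n _]; [exact: hc|exact: hU].
- exists U; split=> // n; rewrite openE => f /separating_open[r r0 rU].
  apply/nbhs_uniformP; exists r => // h fh; apply: rU => x i; exact/ltW/fh.
Qed.
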